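(* Let $s\in\{\tfrac12,1,\tfrac32,\dots\}$ and $p\in[1,\infty]$. For a density operator $\rho$ in the spin-$s$ representation, let $v_\rho(\mathbf e)=\operatorname{tr}\bigl(\rho(\mathbf e\cdot\mathbf L)^2\bigr)-\bigl(\operatorname{tr}\rho\,\mathbf e\cdot\mathbf L\bigr)^2$ be the variance of $\mathbf e\cdot\mathbf L$, for unit vectors $\mathbf e\in\mathbb R^3$, and let $$\|v_\rho\|_p=\Bigl(\int_{S^2}\frac{d\mathbf e}{4\pi}\,v_\rho(\mathbf e)^p\Bigr)^{1/p}\quad(p<\infty),\qquad \|v_\rho\|_\infty=\max_{\mathbf e}v_\rho(\mathbf e),$$ where $d\mathbf e$ is the surface measure on the unit sphere $S^2$. Define $$c(p,s)=\frac s2\left(\frac{\sqrt\pi\,\Gamma(p+1)}{2\,\Gamma(p+\frac32)}\right)^{1/p}\quad(p<\infty),\qquad c(\infty,s)=\frac s2 .$$ Then for every density operator $\rho$ in the spin-$s$ representation $$\|v_\rho\|_p\ \ge\ c(p,s),$$ with equality whenever $\rho$ is a spin coherent state. For $p<\infty$ the spin coherent states are the only states with equality. For $p=\infty$ equality holds also for the mixtures $\rho=q_+|s\rangle\langle s|+q_-|{-s}\rangle\langle{-s}|$ with $q_\pm\ge0$, $q_++q_-=1$, and for rotations $U_R\rho U_R^*$ thereof, provided that $q_+q_-\le 1/(8s)$. Special values of the constant are $c(1,s)=s/3$, $c(2,s)=\frac s2\sqrt{8/15}$, $c(\infty,s)=s/2$.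
   Context: The spin-$s$ representation is the irreducible $(2s+1)$-dimensional unitary representation $R\mapsto U_R$ of $SU(2)$ on $\mathbb C^{2s+1}$, with angular momentum operators $\mathbf L=(L_1,L_2,L_3)$ (with $\hbar=1$, $[L_1,L_2]=iL_3$ and cyclic, $L_1^2+L_2^2+L_3^2=s(s+1)\mathbb 1$), and $\mathbf e\cdot\mathbf L=\sum_j e_jL_j$. $|m\rangle$, $m\in\{-s,-s+1,\dots,s\}$, is the orthonormal eigenbasis of $L_3$, $L_3|m\rangle=m|m\rangle$. A density operator is a positive semidefinite operator of trace 1. A spin coherent state is a state $\rho=|\phi\rangle\langle\phi|$ where $\phi$ is a unit vector with $\mathbf e\cdot\mathbf L\,\phi=s\,\phi$ for some unit vector $\mathbf e\in\mathbb R^3$ (equivalently $\phi=U_R|s\rangle$ up to a phase, for some $R\in SU(2)$). *)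

(* Defs.v *)
From HB Require Import structures.
From mathcomp Require Import all_boot all_order all_algebra.
From mathcomp Require Import sesquilinear spectral complex.
From mathcomp Require Import ring.
From mathcomp Require Import all_classical all_reals all_analysis.

Set Implicit Arguments.
Unset Strict Implicit.
Unset Printing Implicit Defensive.

Import Order.TTheory GRing.Theory Num.Theory.
Import numFieldTopology.Exports numFieldNormedType.Exports.

Local Open Scope classical_set_scope.
Local Open Scope ring_scope.
Local Open Scope complex_scope.
Local Open Scope sesquilinear_scope.

Definition sphere2 (R : realType) : set 'rV[R]_3 :=
  [set e | \sum_(j < 3) e ord0 j ^+ 2 = 1].

(* [(e \cdot A)], also used for the Pauli matrices.  Indices live in
   ['I_3 = Z/3Z], so [A 0, A 1, A 2] are the components A_1, A_2, A_3. *)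
Definition dot_mx (R : realType) (d : nat) (e : 'rV[R]_3)
    (A : 'I_3 -> 'M[R[i]]_d) : 'M[R[i]]_d :=
  \sum_(j < 3) (e ord0 j)%:C *: A j.

Definition mx2 (T : Type) (a b c d : T) : 'M[T]_2 :=
  \matrix_(i, j) if i == 0 then (if j == 0 then a else b)
                 else (if j == 0 then c else d).

Definition pauli (R : realType) (j : 'I_3) : 'M[R[i]]_2 :=
  if j == 0 then mx2 0 1 1 0
  else if j == 1 then mx2 0 (- 'i) 'i 0
  else mx2 1 0 0 (- 1).

Definition SU2 (R : realType) : set 'M[R[i]]_2 :=
  [set g | g \is unitarymx /\ \det g = 1].

(* [exp (- i t (e \cdot sigma) / 2)] for a unit vector [e]. *)
Definition su2_rot (R : realType) (e : 'rV[R]_3) (t : R) : 'M[R[i]]_2 :=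
  (cos (t / 2))%:C *: 1%:M - ('i * (sin (t / 2))%:C) *: dot_mx e (@pauli R).

(* The spin s of the representation on C^(n+1), i.e. n = 2s. *)
Definition spin (R : realType) (n : nat) : R := n%:R / 2.

(* [U] is the spin-[n/2] representation of SU(2) and [L] its triple of angular
   momentum operators: the one-parameter group [t |-> U (su2_rot e t)] is generated
   by [- i (e \cdot L)].  An invariant subspace of column vectors is encoded by
   the row space of the matrix [W] of its transposed vectors, hence the
   transpose in [spin_irr]. *)
Record spin_rep (R : realType) (n : nat) (U : 'M[R[i]]_2 -> 'M[R[i]]_n.+1)
    (L : 'I_3 -> 'M[R[i]]_n.+1) : Prop := SpinRep {
  spin_unitary : forall g, SU2 g -> U g \is unitarymx ;
  spin_one : U 1%:M = 1%:M ;
  spin_mul : forall g h, SU2 g -> SU2 h -> U (g *m h) = U g *m U h ;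
  spin_irr : forall W : 'M[R[i]]_n.+1,
    (forall g, SU2 g -> stablemx W (U g)^T) ->
    \rank W = 0%N \/ \rank W = n.+1 ;
  spin_gen : forall e, sphere2 e ->
    (fun t : R => (t^-1)%:C *: (U (su2_rot e t) - 1%:M)) @ 0^' -->
    (- 'i *: dot_mx e L) ;
  spin_herm : forall j, (L j)^t* = L j ;
  spin_comm : forall j,
    L j *m L (j + 1) - L (j + 1) *m L j = 'i *: L (j + 2) ;
  spin_casimir :
    \sum_(j < 3) L j *m L j = (spin R n * (spin R n + 1))%:C%:M }.

(* Orthonormal eigenbasis of L_3, where [ket k] is the vector |s - k>: thus
   |s> is [ket ord0] and |-s> is [ket ord_max]. *)
Definition L3_basis (R : realType) (n : nat) (L : 'I_3 -> 'M[R[i]]_n.+1)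
    (ket : 'I_n.+1 -> 'cV[R[i]]_n.+1) : Prop :=
  (forall k l, (ket k)^t* *m ket l = (k == l)%:R%:M) /\
  (forall k, L 2 *m ket k = (spin R n - (k : nat)%:R)%:C *: ket k).

Definition pure_state (R : realType) (d : nat) (phi : 'cV[R[i]]_d) : 'M[R[i]]_d :=
  phi *m phi^t*.

(* In the order of [R[i]], [0 <= z] means that z is real and nonnegative, so
   the first condition also forces [rho] to be Hermitian. *)
Definition density_op (R : realType) (d : nat) (rho : 'M[R[i]]_d) : Prop :=
  (forall phi : 'cV[R[i]]_d, 0 <= (phi^t* *m rho *m phi) ord0 ord0) /\
  \tr rho = 1.

Definition spin_coherent (R : realType) (n : nat) (L : 'I_3 -> 'M[R[i]]_n.+1)
    (rho : 'M[R[i]]_n.+1) : Prop :=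
  exists e phi, [/\ sphere2 e, phi^t* *m phi = 1%:M,
    dot_mx e L *m phi = (spin R n)%:C *: phi & rho = pure_state phi].

(* The complex number under [complex.Re] is real whenever [rho] and the [L j]
   are Hermitian. *)
Definition spin_var (R : realType) (n : nat) (L : 'I_3 -> 'M[R[i]]_n.+1)
    (rho : 'M[R[i]]_n.+1) (e : 'rV[R]_3) : R :=
  complex.Re (\tr (rho *m (dot_mx e L *m dot_mx e L)) -
              (\tr (rho *m dot_mx e L)) ^+ 2).

Definition sph (R : realType) (theta phi : R) : 'rV[R]_3 :=
  \row_j [:: sin theta * cos phi; sin theta * sin phi; cos theta]`_j.

(* Integral over the unit sphere for the surface measure, whose area element
   in the coordinates [sph] is [sin theta dtheta dphi]. *)
Definition sphere_int (R : realType) (f : 'rV[R]_3 -> R) : R :=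
  (\int[lebesgue_measure]_(phi in `[0%R, (2 * pi)%R])
    (\int[lebesgue_measure]_(theta in `[0%R, pi])
       (f (sph theta phi) * sin theta)))%R.

(* For p = +oo the supremum is a maximum when [f] is continuous, see
   [sphere_max] and [continuous_spin_var]; the value at -oo is junk. *)
Definition sphere_norm (R : realType) (p : \bar R) (f : 'rV[R]_3 -> R) : R :=
  match p with
  | EFin r => (sphere_int (fun e => f e `^ r) / (4 * pi)) `^ r^-1
  | +oo%E => sup (f @` @sphere2 R)
  | -oo%E => 0
  end.

(* Euler's integral; used only for [0 < x], where it converges. *)
Definition Gamma (R : realType) (x : R) : R :=
  (\int[lebesgue_measure]_(t in `]0%R, +oo[) (t `^ (x - 1) * expR (- t)))%R.

Definition c_spin (R : realType) (p : \bar R) (s : R) : R :=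
  match p with
  | EFin r => s / 2 * (Num.sqrt pi * Gamma (r + 1) /
                     (2 * Gamma (r + 3 / 2))) `^ r^-1
  | +oo%E => s / 2
  | -oo%E => 0
  end.

Lemma continuous_sphere_sum (R : realType) (F : 'I_3 -> 'rV[R]_3 -> R) :
  (forall j, continuous (F j)) -> continuous (fun e => \sum_(j < 3) F j e).
Proof.
move=> hF e.
apply: (@cvg_big _ _ _ _ _ _ _ (nbhs e)) => [|j _]; first exact: add_continuous.
exact: hF.
Qed.

Lemma compact_sphere2 (R : realType) : compact (@sphere2 R).
Proof.
apply: bounded_closed_compact.
  exists 1; split => // x x1 e /= he.
  rewrite [leLHS]/Num.Def.normr/= mx_normrE bigmax_le//.
    exact: le_trans (ltW x1).
  case=> i j _ /=; rewrite (ord1 i).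
  apply: le_trans (ltW x1).
  rewrite -(@ler_pXn2r _ 2)// ?nnegrE// expr1n real_normK ?num_real// -he.
  by rewrite (bigD1 j)//= lerDl sumr_ge0// => k _; rewrite sqr_ge0.
have -> : @sphere2 R = (fun e => \sum_(j < 3) e ord0 j ^+ 2) @^-1` [set 1].
  by [].
apply: preimage_closed; last exact: closed_eq.
move=> e _; apply: continuous_sphere_sum => j {}e.
suff : continuous (fun x : 'rV[R]_3 => x ord0 j * x ord0 j) by exact.
by move=> x; apply: (@cvgM _ _ (nbhs x)); exact: coord_continuous.
Qed.

Lemma sphere2_neq0 (R : realType) : @sphere2 R !=set0.
Proof.
exists (\row_j (j == ord0)%:R); rewrite /sphere2/= !big_ord_recl big_ord0.
by rewrite !mxE/= expr1n !expr0n/= !addr0.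
Qed.

Lemma sphere_max (R : realType) (f : 'rV[R]_3 -> R) : continuous f ->
  exists e, [/\ sphere2 e, f e = sphere_norm +oo%E f &
    forall e', sphere2 e' -> f e' <= f e].
Proof.
move=> cf.
have [e /set_mem he hmax] := EVT_max_rV (@sphere2_neq0 R) (@compact_sphere2 R)
  (continuous_subspaceT cf).
have hle e' : sphere2 e' -> f e' <= f e by move=> h; apply: hmax; rewrite inE.
exists e; split=> //=; apply/eqP; rewrite eq_le; apply/andP; split.
  apply: ub_le_sup; last by exists e.
  by exists (f e) => _ [e' h <-]; exact: hle.
apply: ge_sup; first by exists (f e), e.
by move=> _ [e' h <-]; exact: hle.
Qed.

Lemma spin_varE (R : realType) (n : nat) (L : 'I_3 -> 'M[R[i]]_n.+1)
    (rho : 'M[R[i]]_n.+1) (e : 'rV[R]_3) :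
  spin_var L rho e = \sum_(j < 3) \sum_(k < 3) e ord0 j * (e ord0 k *
    complex.Re (\tr (rho *m (L j *m L k)) -
                \tr (rho *m L j) * \tr (rho *m L k))).
Proof.
have ReZ (x : R) (z : R[i]) : x * complex.Re z = complex.Re (x%:C * z).
  by case: z => a b /=; rewrite mul0r subr0.
have ReD : {morph @complex.Re R : x y / x + y} by case=> ? ? [].
have trD (A : 'M[R[i]]_n.+1) : \tr (A *m dot_mx e L) =
    \sum_(k < 3) (e ord0 k)%:C * \tr (A *m L k).
  rewrite /dot_mx mulmx_sumr raddf_sum/=; apply: eq_bigr => k _.
  by rewrite -scalemxAr mxtraceZ.
rewrite /spin_var mulmxA trD expr2 {1}trD mulr_suml -sumrB.
rewrite (big_morph _ ReD (erefl _)) exchange_big/=.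
apply: eq_bigr => k _.
rewrite mxtrace_mulC mulmxA !trD; move trk : (\tr (rho *m L k)) => t.
rewrite !mulr_sumr -sumrB (big_morph _ ReD (erefl _)).
apply: eq_bigr => j _; rewrite !ReZ; congr complex.Re.
rewrite mulmxA [in RHS]mxtrace_mulC mulmxA; ring.
Qed.

Lemma continuous_spin_var (R : realType) (n : nat)
    (L : 'I_3 -> 'M[R[i]]_n.+1) (rho : 'M[R[i]]_n.+1) :
  continuous (spin_var L rho).
Proof.
have -> : spin_var L rho = fun x => \sum_(j < 3) \sum_(k < 3)
    x ord0 j * (x ord0 k * complex.Re (\tr (rho *m (L j *m L k)) -
                                       \tr (rho *m L j) * \tr (rho *m L k))).
  by apply/funext => x; exact: spin_varE.
apply: continuous_sphere_sum => j; apply: continuous_sphere_sum => k e.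
apply: (@cvgM _ _ (nbhs e)); first exact: coord_continuous.
by apply: (@cvgM _ _ (nbhs e)); [exact: coord_continuous|exact: cvg_cst].
Qed.

(* Main.v *)
Require Import Defs.
From mathcomp Require Import all_boot all_order all_algebra.
From mathcomp Require Import sesquilinear spectral complex.
From mathcomp Require Import ring lra.
From mathcomp Require Import all_classical all_reals all_analysis.
From mathcomp Require Import measurable_realfun lebesgue_integral_fubini gauss_integral.

(** Choose orthonormal axes whose third one points along the mean angular
    momentum. The Casimir relation and L_3^2 <= s^2 then give V_11 + V_22 >= s for
    the covariance matrix V of the state. Averaging the quadratic form v over the
    four rotations by multiples of pi/2 about the third axis replaces it by
    (V_11 + V_22)/2 (x^2 + y^2) + V_33 z^2, and convexity of t |-> t^p shows that
    this does not increase the p-norm. Since t^p is superadditive, the p-th power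
    of the norm is at least ((V_11 + V_22)/2)^p I + V_33^p J, where I and J > 0 are
    the means of (x^2 + y^2)^p and z^(2p). Equality forces V_33 = 0 and
    V_11 + V_22 = s, hence <L_3> = s, and the state is the highest-weight vector of
    the third axis, as all the eigenvalues s, s - 1, ..., - s of L_3 are simple.

    The rotation invariance of the sphere integral, written in polar
    coordinates, is obtained from that about the polar axis and from the cyclic
    permutation of the coordinates, the latter being checked on monomials. *)

Set Implicit Arguments.
Unset Strict Implicit.
Unset Printing Implicit Defensive.

Import Order.TTheory GRing.Theory Num.Theory.
Import numFieldTopology.Exports numFieldNormedType.Exports.

Local Open Scope classical_set_scope.
Local Open Scope ring_scope.
Local Open Scope sesquilinear_scope.

(** * Density matrices *)

Section DensityMatrices.
Context {C : numClosedFieldType}.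

(** With the third axis along the mean angular momentum, the means of [L_1] and [L_2] vanish, so
    [V_11] and [V_22] are plain second moments and the Casimir relation applies to them. The mixed
    entries of [V] remain uncontrolled, hence the averaging. For [p = +oo] the maximum is simply
    compared with the mean of the values on the first two axes.

    The bound [(s/2)^p I] comes from the profile [s/2 (x^2 + y^2)] of a coherent state, and
    [I / (4 pi)], with [I] the unnormalised integral, is half of the integral of [sin^(2p+1)] over
    [[0, pi]]. Integrating [exp(-r) (r - x^2)_+^p] over the plane in both orders turns it into the
    Gamma quotient of [c(p, s)].

    For the mixtures the variance is [s/2 (x^2 + y^2) + 4 s^2 q_+ q_- z^2]; on the sphere it is at
    most [s/2] exactly if [4 s^2 q_+ q_- <= s/2], the origin of [1/(8s)]. For their rotations an
    upper bound at each direction is enough, and conjugation by [U g] preserves it because it maps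
    each [e . L] to some [e' . L]. *)

Lemma adjmxM m n p (A : 'M[C]_(m, n)) (B : 'M[C]_(n, p)) :
  (A *m B)^t* = B^t* *m A^t*.
Proof. by rewrite trmx_mul map_mxM. Qed.

Lemma adjmxD m n (A B : 'M[C]_(m, n)) : (A + B)^t* = A^t* + B^t*.
Proof. by rewrite linearD map_mxD. Qed.

Lemma adjmxZ m n (a : C) (A : 'M[C]_(m, n)) : (a *: A)^t* = a^* *: A^t*.
Proof. by rewrite linearZ map_mxZ. Qed.

Lemma mxtrace_adj n (A : 'M[C]_n) : \tr (A^t*) = (\tr A)^*.
Proof. by rewrite /mxtrace raddf_sum; apply: eq_bigr => i _; rewrite !mxE. Qed.

(** In the order of [C], being nonnegative includes being real, so [t = 0] and [t = 1] show that [a]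
    and [b] are real; a real affine function bounded below is constant. *)
Lemma affine_ge0_slope0 (a b : C) :
  (forall t, t \is Num.real -> 0 <= a + t * b) -> b = 0.
Proof.
move=> h; apply/eqP; apply: contraT => b0.
have a_real : a \is Num.real by have := h 0 (real0 _); rewrite mul0r addr0 => /ger0_real.
have b_real : b \is Num.real.
  have /ger0_real := h 1 (real1 _); rewrite mul1r => hab.
  by rewrite (_ : b = a + b - a); [rewrite rpredB|ring].
(* At this [t] the affine function takes the value [- 1]. *)
have := h (- (a + 1) / b); rewrite divfK// opprD addrA subrr add0r ler0N1.
by apply; rewrite realM// ?realV// realB// ?realN.
Qed.

(** The body of [density_op] over an arbitrary closed field: at [R[i]] the two are convertible, and
    the lemmas below apply to [density_op] as they stand. *)
Definition density d (rho : 'M[C]_d) : Prop :=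
  (forall phi : 'cV[C]_d, 0 <= (phi^t* *m rho *m phi) ord0 ord0) /\ \tr rho = 1.

Section Density.
Context {d : nat}.
Implicit Types (rho M A P : 'M[C]_d) (phi chi : 'cV[C]_d).

Lemma row_sandwich m (A : 'M[C]_(m, d)) M i j :
  (row i A *m M *m (row j A)^t*) ord0 ord0 = (A *m M *m A^t*) i j.
Proof.
rewrite !mxE; apply: eq_bigr => k _; rewrite !mxE; congr (_ * _).
by apply: eq_bigr => l _; rewrite !mxE.
Qed.

Lemma density_sandwich_ge0 rho m (A : 'M[C]_(m, d)) i : density rho ->
  0 <= (A *m rho *m A^t*) i i.
Proof.
by move=> [rho0 _]; rewrite -row_sandwich; have := rho0 ((row i A)^t*); rewrite trmxCK.
Qed.

(** The usual argument for positive semidefinite matrices: on the combination of rows [j] and [i]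
    with coefficients [1] and [c], the term in [|c|^2] carries the vanishing diagonal entry, which
    leaves an expression affine in [c]. *)
Lemma density_diag0 rho m (Q : 'M[C]_(m, d)) i j :
  density rho -> (Q *m rho *m Q^t*) i i = 0 ->
  (Q *m rho *m Q^t*) j i = 0 /\ (Q *m rho *m Q^t*) i j = 0.
Proof.
move=> hrho sii; set sg := Q *m rho *m Q^t* in sii *.
have pos (c : C) : 0 <= sg j j + (c^* * sg j i + c * sg i j).
  have := density_sandwich_ge0 (row j Q + c *: row i Q) ord0 hrho.
  have B2 (u v w z : 'rV[C]_d) : ((u + c *: v) *m rho *m (w + c *: z)^t*) ord0 ord0 =
      (u *m rho *m w^t*) ord0 ord0 + (c^* * (u *m rho *m z^t*) ord0 ord0 +
      c * (v *m rho *m w^t*) ord0 ord0) + c * c^* * (v *m rho *m z^t*) ord0 ord0.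
    rewrite adjmxD adjmxZ !mulmxDl !mulmxDr -!scalemxAr -!scalemxAl.
    have e2 (A B : 'M[C]_1) : (A + B) ord0 ord0 = A ord0 ord0 + B ord0 ord0 by rewrite mxE.
    have e3 a (A : 'M[C]_1) : (a *: A) ord0 ord0 = a * A ord0 ord0 by rewrite mxE.
    by rewrite !e2 !e3 (mulrC c c^*) -!mulrA !addrA.
  by rewrite B2 !row_sandwich -/sg sii mulr0 addr0.
have h1 : sg j i + sg i j = 0.
  apply: (@affine_ge0_slope0 (sg j j)) => t /CrealP tt.
  by have := pos t; rewrite tt -mulrDr.
(* Real [c] has given the sum of the two entries; purely imaginary [c] gives their difference. *)
have h2 : sg j i - sg i j = 0.
  suff : - 'i * (sg j i - sg i j) = 0.
    by move/eqP; rewrite mulf_eq0 oppr_eq0 (negbTE (neq0Ci _)) => /eqP.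
  apply: (@affine_ge0_slope0 (sg j j)) => t /CrealP tt.
  have := pos (t * 'i); rewrite rmorphM /= tt conjCi.
  suff -> : t * - 'i * sg j i + t * 'i * sg i j = t * (- 'i * (sg j i - sg i j)) by [].
  by ring.
have sji : sg j i = 0.
  have /eqP := congr2 +%R h1 h2.
  by rewrite addr0 addrACA subrr addr0 -mulr2n mulrn_eq0 => /eqP.
by split=> //; rewrite -[LHS]add0r -[in LHS]sji.
Qed.

Lemma cvec_normsq_ge0 phi : 0 <= (phi^t* *m phi) ord0 ord0.
Proof. by rewrite mxE sumr_ge0// => k _; rewrite !mxE mulrC -normCK exprn_ge0. Qed.

Lemma cvec_normsq_eq0 phi : ((phi^t* *m phi) ord0 ord0 == 0) = (phi == 0).
Proof.
apply/eqP/eqP => [|->]; last by rewrite mulmx0 mxE.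
rewrite mxE => /eqP; rewrite psumr_eq0; last first.
  by move=> k _; rewrite !mxE mulrC -normCK exprn_ge0.
move=> /allP h; apply/colP => k; have := h k; rewrite mem_index_enum => /(_ isT).
by rewrite !mxE mulrC -normCK expf_eq0 normr_eq0/= => /eqP.
Qed.

Lemma pure_density phi : phi^t* *m phi = 1%:M -> density (phi *m phi^t*).
Proof.
move=> phi1; split; last by rewrite mxtrace_mulC phi1 mxtrace1.
move=> chi; rewrite (_ : _ *m _ = (phi^t* *m chi)^t* *m (phi^t* *m chi)); last first.
  by rewrite adjmxM trmxCK !mulmxA.
by rewrite mxE big_ord1 !mxE mulrC -normCK exprn_ge0.
Qed.

Lemma mix_density (q q' : C) rho rho' : 0 <= q -> 0 <= q' -> q + q' = 1 ->
  density rho -> density rho' -> density (q *: rho + q' *: rho').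
Proof.
move=> q0 q0' qq [h1 h2] [h1' h2']; split.
  move=> phi; rewrite mulmxDr mulmxDl -!scalemxAr -!scalemxAl.
  set x := _ *m _ *m _; set y := _ *m _ *m _.
  rewrite [_ ord0 ord0](_ : _ = q * x ord0 ord0 + q' * y ord0 ord0); last by rewrite !mxE.
  by rewrite addr_ge0// mulr_ge0// ?h1 ?h1'.
by rewrite mxtraceD !mxtraceZ h2 h2' !mulr1.
Qed.

Lemma conj_density rho P : P^t* *m P = 1%:M -> density rho -> density (P *m rho *m P^t*).
Proof.
move=> PP [h1 h2]; split; last by rewrite mxtrace_mulC mulmxA PP mul1mx.
move=> phi; have := h1 (P^t* *m phi); rewrite adjmxM trmxCK !mulmxA.
by rewrite -!mulmxA.
Qed.

Lemma mxtrace_pure phi M : \tr (phi *m phi^t* *m M) = (phi^t* *m M *m phi) ord0 ord0.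
Proof.
rewrite mxtrace_mulC mulmxA mxtrace_mulC mulmxA /mxtrace big_ord1.
by congr (_ _ _); apply: val_inj.
Qed.

Lemma hermitian_spectral M : M^t* = M ->
  exists P (a : 'I_d -> C), [/\ P^t* *m P = 1%:M, P *m P^t* = 1%:M,
    forall i, a i \is Num.real & M = P^t* *m diag_mx (\row_i a i) *m P].
Proof.
move=> hM.
have Mh : M \is hermsymmx by rewrite is_hermitianmxE expr0 scale1r hM.
exists (spectralmx M), (fun i => spectral_diag M ord0 i).
have PU := spectral_unitarymx M.
have PI := invmx_unitary PU.
split.
- by rewrite -PI mulVmx// spectral_unit.
- by rewrite -PI mulmxV// spectral_unit.
- by move=> i; have /mxOverP/(_ ord0 i) := hermitian_spectral_diag_real Mh.
- rewrite -PI; have /hermitian_normalmx/orthomx_spectralP ME := Mh; rewrite {1}ME.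
  suff -> : \row_i spectral_diag M ord0 i = spectral_diag M by [].
  by apply/rowP => i; rewrite mxE.
Qed.

(** The Born rule: in an eigenbasis of [M] the diagonal of [rho] is a probability distribution [r]
    on the eigenvalues, and the quantum moments of [M] become its classical moments. *)
Lemma spectral_distribution rho M P (a : 'I_d -> C) : density rho ->
  P^t* *m P = 1%:M -> M = P^t* *m diag_mx (\row_i a i) *m P ->
  exists r : 'I_d -> C, [/\ forall i, 0 <= r i, \sum_i r i = 1,
    \tr (rho *m M) = \sum_i a i * r i, \tr (rho *m (M *m M)) = \sum_i a i ^+ 2 * r i &
    forall i, (P *m rho *m P^t*) i i = r i].
Proof.
move=> hrho PP ->; pose r i := (P *m rho *m P^t*) i i.
have trE E : \tr (rho *m (P^t* *m E *m P)) = \tr (P *m rho *m P^t* *m E).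
  by rewrite mulmxA mxtrace_mulC !mulmxA.
have diagE (b : 'I_d -> C) :
    \tr (P *m rho *m P^t* *m diag_mx (\row_i b i)) = \sum_i b i * r i.
  by apply: eq_bigr => i _; rewrite mul_mx_diag mxE [X in _ * X]mxE mulrC.
exists r; split => //.
- by move=> i; exact: density_sandwich_ge0.
- rewrite -(hrho.2); have := diagE (fun=> 1).
  rewrite (_ : diag_mx _ = 1%:M); last first.
    by rewrite -diag_const_mx; congr diag_mx; apply/rowP => i; rewrite !mxE.
  rewrite mulmx1 mxtrace_mulC mulmxA PP mul1mx => ->.
  by apply: eq_bigr => i _; rewrite mul1r.
- by rewrite trE diagE.
- have PPt : P *m P^t* = 1%:M by exact: mulmx1C.
  rewrite -(diagE (fun i => a i ^+ 2)) -trE; congr (\tr (_ *m _)).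
  rewrite -!mulmxA; congr (_ *m _); rewrite !mulmxA; congr (_ *m _).
  rewrite -!mulmxA (mulmxA P) PPt mul1mx mulmx_diag; congr diag_mx.
  by apply/rowP => i; rewrite !mxE expr2.
Qed.

Lemma trace_herm_real rho M : density rho -> M^t* = M -> \tr (rho *m M) \is Num.real.
Proof.
move=> hrho /hermitian_spectral[P [a [PP _ ar ME]]].
have [r [r0 _ -> _ _]] := spectral_distribution hrho PP ME.
by apply: rpred_sum => i _; rewrite rpredM// ger0_real.
Qed.

(** By [spectral_distribution] this is the variance of a classical random variable. *)
Lemma trace_variance_ge0 rho M : density rho -> M^t* = M ->
  0 <= \tr (rho *m (M *m M)) - (\tr (rho *m M)) ^+ 2.
Proof.
move=> hrho /hermitian_spectral[P [a [PP _ ar ME]]].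
have [r [r0 r1 -> -> _]] := spectral_distribution hrho PP ME.
set m := \sum_i a i * _.
have m_real : m \is Num.real.
  by rewrite /m; apply: rpred_sum => i _; rewrite rpredM// ger0_real.
rewrite [X in 0 <= X](_ : _ = \sum_i (a i - m) ^+ 2 * r i).
  apply: sumr_ge0 => i _; rewrite mulr_ge0//.
  by rewrite real_exprn_even_ge0// realB.
transitivity (\sum_i a i ^+ 2 * r i - m * 2 * m + m ^+ 2 * \sum_i r i).
  by rewrite r1; ring.
rewrite {2}/m !mulr_sumr -sumrB -big_split/=; apply: eq_bigr => i _; ring.
Qed.

End Density.
End DensityMatrices.

(** * Angular momentum *)

Lemma ord3E : ((0 + 1 = 1 :> 'I_3)%R * (0 + 2 = 2 :> 'I_3)%R * (1 + 1 = 2 :> 'I_3)%R *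
  (1 + 2 = 0 :> 'I_3)%R * (2 + 1 = 0 :> 'I_3)%R * (2 + 2 = 1 :> 'I_3)%R)%type.
Proof. by do !split; apply: val_inj. Qed.

Lemma ord3_ind (P : 'I_3 -> Prop) : P 0 -> P 1 -> P 2 -> forall j, P j.
Proof.
move=> P0 P1 P2 [[|[|[|//]]] hj].
- by rewrite (_ : Ordinal hj = 0)//; exact: val_inj.
- by rewrite (_ : Ordinal hj = 1)//; exact: val_inj.
- by rewrite (_ : Ordinal hj = 2)//; exact: val_inj.
Qed.

Lemma sum3 (V : nmodType) (F : 'I_3 -> V) : \sum_(j < 3) F j = F 0 + F 1 + F 2.
Proof.
rewrite !big_ord_recl big_ord0 addr0 addrA.
by congr (_ + _ + _); congr F; apply: val_inj.
Qed.

(** * Matrix identities that follow from the commutation relations *)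

Section CommutatorAlgebra.
Context {C : comNzRingType} {d : nat}.
Variables (A B D : 'M[C]_d) (im : C).

Lemma rot_commutator (u w : C) : u ^+ 2 + w ^+ 2 = 1 -> A *m B = B *m A + im *: D ->
  (u *: A + w *: B) *m (- w *: A + u *: B) -
  (- w *: A + u *: B) *m (u *: A + w *: B) = im *: D.
Proof.
move=> uw c0; rewrite !mulmxDl !mulmxDr -!scalemxAl -!scalemxAr c0.
(* The relation [c0] has brought all products into one order; once these are frozen as opaque
   matrices, only a commutative identity between entries is left. The identities below are proved in
   the same way. *)
move: (A *m A) (B *m A) (B *m B) => AA BA BB.
apply/matrixP => k l; rewrite !mxE; move: (AA k l) (BA k l) (BB k l) (D k l) => x y z t.
by transitivity ((u ^+ 2 + w ^+ 2) * (im * t)); [ring|rewrite uw mul1r].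
Qed.

Lemma rot_sqr_sum (u w : C) : u ^+ 2 + w ^+ 2 = 1 ->
  (u *: A + w *: B) *m (u *: A + w *: B) +
  (- w *: A + u *: B) *m (- w *: A + u *: B) = A *m A + B *m B.
Proof.
move=> uw; rewrite !mulmxDl !mulmxDr -!scalemxAl -!scalemxAr.
move: (A *m A) (A *m B) (B *m A) (B *m B) => AA AB BA BB.
apply/matrixP => k l; rewrite !mxE; move: (AA k l) (AB k l) (BA k l) (BB k l) => x t y z.
by transitivity ((u ^+ 2 + w ^+ 2) * (x + z)); [ring|rewrite uw mul1r].
Qed.

Lemma lin_commutator (u w : C) : B *m D = D *m B + im *: A -> D *m A = A *m D + im *: B ->
  (u *: A + w *: B) *m D - D *m (u *: A + w *: B) = im *: (w *: A - u *: B).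
Proof.
move=> c1 c2; rewrite mulmxDl mulmxDr -!scalemxAl -!scalemxAr c1 c2.
by move: (A *m D) (D *m B) => X Y; apply/matrixP => k l; rewrite !mxE; ring.
Qed.

Lemma ladder_commutator (e : C) : e ^+ 2 = 1 -> im * im = - 1 ->
  B *m D = D *m B + im *: A -> D *m A = A *m D + im *: B ->
  D *m (A + (e * im) *: B) = (A + (e * im) *: B) *m D + e *: (A + (e * im) *: B).
Proof.
move=> e1 im1 c1 c2; rewrite !mulmxDl !mulmxDr -!scalemxAl -!scalemxAr c1 c2.
move: (A *m D) (D *m B) => X Y.
apply/matrixP => k l; rewrite !mxE; move: (X k l) (Y k l) (A k l) (B k l) => x y z t.
transitivity (x + e * im * y + e * (im * im) * z + e * z + e ^+ 2 * im * t).
  by rewrite e1 im1; ring.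
by ring.
Qed.

Lemma ladder_sqr (e : C) : e ^+ 2 = 1 -> im * im = - 1 -> A *m B = B *m A + im *: D ->
  (A - (e * im) *: B) *m (A + (e * im) *: B) = A *m A + B *m B - e *: D.
Proof.
move=> e1 im1 c0; rewrite mulmxBl !mulmxDr -!scalemxAl -!scalemxAr c0.
move: (A *m A) (B *m A) (B *m B) => AA BA BB.
apply/matrixP => k l; rewrite !mxE; move: (AA k l) (BA k l) (BB k l) (D k l) => x y z t.
transitivity (x + e * (im * im) * t - e ^+ 2 * (im * im) * z); first ring.
by rewrite e1 im1; ring.
Qed.

Lemma lin3_rotz (a b c u w : C) :
  a *: (u *: A + w *: B) + b *: (- w *: A + u *: B) + c *: D =
  (u * a - w * b) *: A + (w * a + u * b) *: B + c *: D.
Proof. by apply/matrixP => k l; rewrite !mxE; ring. Qed.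

Lemma lin3_nested (u w z r : C) :
  z *: D + r *: (u *: A + w *: B) = (r * u) *: A + (r * w) *: B + z *: D.
Proof. by rewrite scalerDr !scalerA addrC. Qed.

Lemma trace_lin2 (a b : C) : \tr (D *m (a *: A + b *: B)) =
  a * \tr (D *m A) + b * \tr (D *m B).
Proof. by rewrite mulmxDr mxtraceD -!scalemxAr !mxtraceZ. Qed.

Lemma trace_lin2l (a b : C) : \tr ((a *: A + b *: B) *m D) =
  a * \tr (A *m D) + b * \tr (B *m D).
Proof. by rewrite mulmxDl mxtraceD -!scalemxAl !mxtraceZ. Qed.

End CommutatorAlgebra.

Lemma lin3_herm (C : numClosedFieldType) (d : nat) (L : 'I_3 -> 'M[C]_d) (a b c : C) :
  (forall j, (L j)^t* = L j) -> a \is Num.real -> b \is Num.real -> c \is Num.real ->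
  (a *: L 0 + b *: L 1 + c *: L 2)^t* = a *: L 0 + b *: L 1 + c *: L 2.
Proof.
move=> h /CrealP ar /CrealP br /CrealP cr.
by rewrite !adjmxD !adjmxZ ar br cr !h.
Qed.

(** The Lie-algebraic part of [spin_rep], detached from the group so that it is visibly stable under
    the changes of axes [am_cyc] and [am_rotz]. *)
Record angular_momentum (C : numClosedFieldType) (d : nat) (s : C)
    (L : 'I_3 -> 'M[C]_d) : Prop := AngularMomentum {
  am_herm : forall j, (L j)^t* = L j ;
  am_comm : forall j, L j *m L (j + 1) - L (j + 1) *m L j = 'i *: L (j + 2) ;
  am_casimir : \sum_(j < 3) L j *m L j = (s * (s + 1))%:M }.

Section AngularMomentum.
Context {C : numClosedFieldType} {d : nat} {s : C}.
Implicit Types (L : 'I_3 -> 'M[C]_d) (phi : 'cV[C]_d).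

Lemma am_commE L : angular_momentum s L ->
  [/\ L 0 *m L 1 = L 1 *m L 0 + 'i *: L 2, L 1 *m L 2 = L 2 *m L 1 + 'i *: L 0 &
      L 2 *m L 0 = L 0 *m L 2 + 'i *: L 1].
Proof.
move=> h.
by split; [have := am_comm h 0|have := am_comm h 1|have := am_comm h 2];
  rewrite !ord3E => <-; rewrite addrC subrK.
Qed.

Lemma am_cyc L : angular_momentum s L -> angular_momentum s (fun j => L (j + 1)).
Proof.
move=> h; split.
- by move=> j; exact: (am_herm h).
- by move=> j; rewrite (am_comm h (j + 1)) -!addrA (addrC 1 2).
- by rewrite -(am_casimir h) !sum3 !ord3E addrC addrA.
Qed.

(** Change of axes about the third one; on directions it acts as [rotz], see [dot_rotz]. *)
Definition rotz_triple (u w : C) L : 'I_3 -> 'M[C]_d := fun j =>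
  if j == 0 then u *: L 0 + w *: L 1
  else if j == 1 then - w *: L 0 + u *: L 1 else L 2.

Lemma am_rotz (u w : C) L : u \is Num.real -> w \is Num.real ->
  u ^+ 2 + w ^+ 2 = 1 -> angular_momentum s L -> angular_momentum s (rotz_triple u w L).
Proof.
move=> ur wr uw h; have [c0 c1 c2] := am_commE h.
have hlin (a b : C) : a \is Num.real -> b \is Num.real ->
    (a *: L 0 + b *: L 1)^t* = a *: L 0 + b *: L 1.
  by move=> /CrealP ar /CrealP br; rewrite adjmxD !adjmxZ ar br !(am_herm h).
split.
- elim/ord3_ind; rewrite /rotz_triple/=; [exact: hlin| |exact: (am_herm h)].
  by apply: hlin; rewrite ?realN.
- elim/ord3_ind; rewrite !ord3E /rotz_triple/=.
  + exact: rot_commutator.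
  + by rewrite (lin_commutator _ _ c1 c2) scaleNr opprK.
  + rewrite -opprB (lin_commutator _ _ c1 c2) -scalerN opprB.
    by rewrite addrC -scaleNr.
- rewrite -(am_casimir h) !sum3 /rotz_triple/=; congr (_ + _).
  exact: rot_sqr_sum.
Qed.

(** The raising operator for [e = 1], the lowering operator for [e = - 1]; both signs are treated at
    once through [e ^+ 2 = 1]. *)
Definition ladder (e : C) L : 'M[C]_d := L 0 + (e * 'i) *: L 1.

Lemma imag_sqr : 'i * 'i = - 1 :> C.
Proof. by rewrite -expr2 sqrCi. Qed.

Lemma ladder_comm (e : C) L : e ^+ 2 = 1 -> angular_momentum s L ->
  L 2 *m ladder e L = ladder e L *m L 2 + e *: ladder e L.
Proof.
move=> e1 h; have [c0 c1 c2] := am_commE h.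
exact: (ladder_commutator e1 imag_sqr).
Qed.

(** The adjoint of the ladder operator times the operator itself is the Casimir scalar minus
    [L 2 *m L 2] minus [e *: L 2], which acts on [phi] as a number. *)
Lemma ladder_norm (e : C) L phi (mu : C) : e \is Num.real -> e ^+ 2 = 1 ->
  angular_momentum s L -> L 2 *m phi = mu *: phi ->
  ((ladder e L *m phi)^t* *m (ladder e L *m phi)) ord0 ord0 =
  (s * (s + 1) - mu ^+ 2 - e * mu) * (phi^t* *m phi) ord0 ord0.
Proof.
move=> /CrealP er e1 h Lphi; have [c0 c1 c2] := am_commE h.
have Nadj : (ladder e L)^t* = L 0 - (e * 'i) *: L 1.
  rewrite /ladder adjmxD adjmxZ !(am_herm h) rmorphM /= er conjCi.
  by rewrite mulrN scaleNr.
have NN : (ladder e L)^t* *m ladder e L = (s * (s + 1))%:M - L 2 *m L 2 - e *: L 2.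
  by rewrite Nadj -(am_casimir h) sum3 addrK; exact: (ladder_sqr e1 imag_sqr).
rewrite adjmxM mulmxA -(mulmxA _ _ (ladder e L)) NN -mulmxA !mulmxBl.
rewrite mul_scalar_mx -mulmxA Lphi -scalemxAr Lphi -!scalemxAl Lphi scalerA scalerA.
by rewrite -!scalerBl -scalemxAr mxE expr2.
Qed.

(** Squared norms are nonnegative in [ladder_norm]; with [e] the sign of [mu] the factor there is
    [(s - |mu|) (s + |mu| + 1)], so [|mu| > s] is impossible. *)
Lemma eigenvalue_bound L phi (mu : C) : 0 <= s -> mu \is Num.real ->
  angular_momentum s L -> L 2 *m phi = mu *: phi -> phi != 0 -> `|mu| <= s.
Proof.
move=> s0 mur h Lphi phi0.
have phi_gt0 : 0 < (phi^t* *m phi) ord0 ord0.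
  by rewrite lt_def cvec_normsq_ge0 cvec_normsq_eq0 phi0.
have key (e : C) : e \is Num.real -> e ^+ 2 = 1 -> 0 <= s * (s + 1) - mu ^+ 2 - e * mu.
  move=> er e1; have := cvec_normsq_ge0 (ladder e L *m phi).
  by rewrite (ladder_norm er e1 h Lphi) pmulr_lge0.
have abs : 0 <= s * (s + 1) - `|mu| ^+ 2 - `|mu|.
  rewrite real_normK//; have [m0|m0] := real_ge0P mur.
    by have := key 1 (real1 _) (expr1n _ _); rewrite mul1r.
  by have := key (- 1); rewrite sqrrN expr1n mulN1r realN; apply.
rewrite real_leNgt ?normr_real ?ger0_real//; apply/negP => lt.
have : s * (s + 1) - `|mu| ^+ 2 - `|mu| < 0.
  rewrite (_ : _ - _ = (s - `|mu|) * (s + `|mu| + 1)); last by ring.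
  by rewrite nmulr_rlt0 ?subr_lt0// ltr_wpDl// addr_ge0.
by move=> /(le_lt_trans abs); rewrite ltxx.
Qed.

Lemma spectral_col L P (a : 'I_d -> C) i : P^t* *m P = 1%:M ->
  L 2 = P^t* *m diag_mx (\row_i a i) *m P ->
  L 2 *m col i (P^t*) = a i *: col i (P^t*) /\
  (col i (P^t*))^t* *m col i (P^t*) = 1%:M.
Proof.
move=> PP LE; have PPt : P *m P^t* = 1%:M by exact: mulmx1C.
split.
  rewrite !colE mulmxA LE -!mulmxA (mulmxA P) PPt mul1mx -colE scalemxAr.
  congr (_ *m _); apply/colP => k; rewrite !mxE /=.
  by rewrite andbT; case: eqP => [->|]; rewrite ?mulr1 ?mulr0 ?mulr0n.
rewrite colE adjmxM trmxCK -mulmxA (mulmxA P) PPt mul1mx.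
rewrite trmx_delta map_delta_mx mul_delta_mx; apply/matrixP => k l.
by rewrite !mxE !ord1.
Qed.

Lemma second_moment_le L (rho : 'M[C]_d) : 0 <= s -> angular_momentum s L ->
  density rho -> \tr (rho *m (L 2 *m L 2)) <= s ^+ 2.
Proof.
move=> s0 h hrho; have [P [a [PP PPt ar LE]]] := hermitian_spectral (am_herm h 2).
have [r [r0 r1 _ -> _]] := spectral_distribution hrho PP LE.
rewrite -[leRHS]mulr1 -r1 mulr_sumr ler_sum// => i _; rewrite ler_wpM2r//.
have [Lc c1] := spectral_col i PP LE.
rewrite -real_normK// ler_pXn2r ?nnegrE//.
apply: (eigenvalue_bound s0 (ar i) h Lc).
by apply/eqP => c0; move: c1; rewrite c0 mulmx0 => /matrixP/(_ ord0 ord0)/eqP;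
  rewrite !mxE eq_sym oner_eq0.
Qed.

Lemma transverse_moment_ge L (rho : 'M[C]_d) : 0 <= s -> angular_momentum s L ->
  density rho -> s <= \tr (rho *m (L 0 *m L 0)) + \tr (rho *m (L 1 *m L 1)).
Proof.
move=> s0 h hrho; have := second_moment_le s0 h hrho.
have /(congr1 (fun X => \tr (rho *m X))) := am_casimir h.
rewrite sum3 !mulmxDr !mxtraceD mul_mx_scalar mxtraceZ hrho.2 mulr1.
move: (\tr _ + _) (\tr (rho *m (L 2 *m L 2))) => x y xy hy.
by rewrite -(lerD2r y) xy mulrDr mulr1 -expr2 addrC lerD2r.
Qed.

Lemma transverse_moment_eq L (rho : 'M[C]_d) : angular_momentum s L ->
  density rho -> \tr (rho *m (L 0 *m L 0)) + \tr (rho *m (L 1 *m L 1)) = s ->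
  \tr (rho *m (L 2 *m L 2)) = s ^+ 2.
Proof.
move=> h hrho E; have /(congr1 (fun X => \tr (rho *m X))) := am_casimir h.
rewrite sum3 !mulmxDr !mxtraceD mul_mx_scalar mxtraceZ hrho.2 mulr1 E.
by move=> /(canRL (addKr _)) ->; ring.
Qed.

(** The sign [e] covers highest and lowest weight together. The ladder operator in the direction [e]
    kills [phi], so [L 1 *m phi] is [e * 'i] times [chi = L 0 *m phi], and [M] maps [phi] into the
    span of [chi] and [phi]. It remains to see that [chi] is orthogonal to [phi] and has squared
    norm [s / 2]. *)
Lemma extremal_moments L phi (e x y z : C) : angular_momentum s L ->
  e \is Num.real -> e ^+ 2 = 1 -> s \is Num.real ->
  x \is Num.real -> y \is Num.real -> z \is Num.real ->
  phi^t* *m phi = 1%:M -> L 2 *m phi = (e * s) *: phi ->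
  let M := x *: L 0 + y *: L 1 + z *: L 2 in
  \tr (phi *m phi^t* *m M) = z * e * s /\
  \tr (phi *m phi^t* *m (M *m M)) = s / 2 * (x ^+ 2 + y ^+ 2) + z ^+ 2 * s ^+ 2.
Proof.
move=> h er e1 sr xr yr zr phi1 Lphi M.
have phi11 : (phi^t* *m phi) ord0 ord0 = 1 by rewrite phi1 mxE.
have Nphi : ladder e L *m phi = 0.
  apply/eqP; rewrite -cvec_normsq_eq0 (ladder_norm er e1 h Lphi).
  by rewrite phi11 mulr1 exprMn e1 mulrA -expr2 e1; apply/eqP; ring.
pose chi := L 0 *m phi.
have L1phi : L 1 *m phi = (e * 'i) *: chi.
  have : (e * 'i) *: (ladder e L *m phi) = 0 by rewrite Nphi scaler0.
  rewrite /ladder mulmxDl -scalemxAl scalerDr scalerA -/chi.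
  rewrite (_ : e * 'i * (e * 'i) = - 1).
    by rewrite scaleN1r => /eqP; rewrite subr_eq0 => /eqP.
  by rewrite mulrACA -!expr2 e1 sqrCi mul1r.
pose E (X : 'M[C]_d) := (phi^t* *m X *m phi) ord0 ord0.
have E_real X : X^t* = X -> (E X)^* = E X.
  move=> hX; rewrite /E -[RHS](_ : ((phi^t* *m X *m phi)^t*) ord0 ord0 = _).
    by rewrite [in RHS]mxE [in RHS]mxE.
  by rewrite !adjmxM hX trmxCK mulmxA.
(* The expectations of [L 0] and [L 1] are both real, yet one is [e * 'i] times the other. *)
have E0 : (phi^t* *m chi) ord0 ord0 = 0.
  have r0 := E_real _ (am_herm h 0); have r1 := E_real _ (am_herm h 1).
  have EE : E (L 1) = (e * 'i) * E (L 0).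
    by rewrite /E -!mulmxA L1phi -scalemxAr mxE.
  rewrite mulmxA -/(E (L 0)); move: r1.
  rewrite EE !rmorphM /= r0 (CrealP er) conjCi mulrN mulNr => /eqP.
  rewrite eqNr mulf_eq0 mulf_eq0 (negbTE (neq0Ci _)) orbF.
  have e0 : e != 0 by apply/eqP => e0; move: e1; rewrite e0 expr0n => /esym/eqP; rewrite oner_eq0.
  by rewrite (negbTE e0) => /eqP.
have E0' : (chi^t* *m phi) ord0 ord0 = 0.
  have -> : chi^t* *m phi = (phi^t* *m chi)^t* by rewrite adjmxM trmxCK.
  by rewrite mxE mxE E0 conjC0.
have Mphi : M *m phi = (x + y * (e * 'i)) *: chi + (z * (e * s)) *: phi.
  by rewrite /M !mulmxDl -!scalemxAl L1phi Lphi -/chi !scalerA scalerDl.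
have Mh : M^t* = M.
  by rewrite /M !adjmxD !adjmxZ !(am_herm h) !(CrealP _).
pose q := (chi^t* *m chi) ord0 ord0.
have e2 (A B : 'M[C]_1) : (A + B) ord0 ord0 = A ord0 ord0 + B ord0 ord0 by rewrite mxE.
have e3 a (A : 'M[C]_1) : (a *: A) ord0 ord0 = a * A ord0 ord0 by rewrite mxE.
have EMM : (phi^t* *m (M *m M) *m phi) ord0 ord0 =
    (x ^+ 2 + y ^+ 2) * q + z ^+ 2 * s ^+ 2.
  have -> : phi^t* *m (M *m M) *m phi = (M *m phi)^t* *m (M *m phi).
    by rewrite adjmxM Mh !mulmxA.
  rewrite Mphi adjmxD !adjmxZ mulmxDl !mulmxDr -!scalemxAr -!scalemxAl !scalerA.
  rewrite !e2 !e3 E0 E0' phi11 -/q !rmorphD /= !rmorphM /= conjCi !(CrealP _)//.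
  transitivity ((x ^+ 2 - y ^+ 2 * e ^+ 2 * 'i ^+ 2) * q + z ^+ 2 * s ^+ 2 * e ^+ 2); first ring.
  by rewrite e1 sqrCi; ring.
(* The Casimir relation in the state [phi] reads [2 q + s^2 = s (s + 1)]. *)
have qE : q = s / 2.
  have /(congr1 (fun X => (phi^t* *m X *m phi) ord0 ord0)) := am_casimir h.
  rewrite sum3 mul_mx_scalar -scalemxAl e3 phi11 mulr1 !mulmxDr !mulmxDl !e2.
  have EXX j : (phi^t* *m (L j *m L j) *m phi) ord0 ord0 =
      ((L j *m phi)^t* *m (L j *m phi)) ord0 ord0.
    by rewrite adjmxM (am_herm h) !mulmxA.
  rewrite !EXX L1phi Lphi !adjmxZ -!scalemxAr -!scalemxAl !e3 -/q phi11.
  rewrite !rmorphM /= conjCi !(CrealP _)// => hq.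
  have : 2 * q = s.
    rewrite -[RHS](addrK (s ^+ 2)).
    transitivity (q + (e * e) * (- ('i * 'i)) * q).
      by rewrite -!expr2 e1 sqrCi; ring.
    apply: (addIr (e * s * (e * s * 1))).
    transitivity (s * (s + 1)); first by rewrite -hq; ring.
    by transitivity (s + s ^+ 2 - s ^+ 2 + e ^+ 2 * s ^+ 2); [rewrite e1|]; ring.
  by move=> <-; rewrite mulrAC divff ?mul1r// pnatr_eq0.
split; rewrite mxtrace_pure.
  by rewrite -mulmxA Mphi mulmxDr -!scalemxAr e2 !e3 E0 phi11 mulr0 add0r mulr1 mulrA.
by rewrite EMM qE mulrC.
Qed.

End AngularMomentum.

Section SpinHalfInteger.
Context {C : numClosedFieldType} {n : nat}.
Local Notation s := (n%:R / 2 : C).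
Implicit Types (L : 'I_3 -> 'M[C]_n.+1).

(* Applying the lowering operator to a highest-weight vector produces all of
   s, s - 1, ..., - s as eigenvalues, so that each of them is simple. *)
Lemma highest_weight_pure L (rho : 'M[C]_n.+1) : angular_momentum s L ->
  density rho -> \tr (rho *m L 2) = s ->
  exists phi : 'cV[C]_n.+1, [/\ phi^t* *m phi = 1%:M, L 2 *m phi = s *: phi &
    rho = phi *m phi^t*].
Proof.
move=> h hrho; have [P [a [PP PPt ar LE]]] := hermitian_spectral (am_herm h 2).
have [r [r0 r1 -> _ rE]] := spectral_distribution hrho PP LE.
have s0 : 0 <= s by rewrite divr_ge0// ler0n.
have col0 i : col i (P^t*) != 0.
  have [_ c1] := spectral_col i PP LE.
  by apply/eqP => c0; move: c1; rewrite c0 mulmx0 => /matrixP/(_ ord0 ord0)/eqP;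
    rewrite !mxE eq_sym oner_eq0.
have a_le i : a i <= s.
  have [Lc _] := spectral_col i PP LE.
  apply: le_trans (eigenvalue_bound s0 (ar i) h Lc (col0 i)).
  exact: real_ler_norm.
move=> ars.
(* The mean equals the largest possible eigenvalue, so the distribution [r] lives on the indices
   with [a i = s]. *)
have : \sum_i (s - a i) * r i == 0.
  by under eq_bigr do rewrite mulrBl; rewrite sumrB -mulr_sumr r1 ars mulr1 subrr.
rewrite psumr_eq0; last by move=> i _; rewrite mulr_ge0// subr_ge0.
move=> /allP sr0; have {}sr0 i : (s - a i) * r i = 0.
  by have := sr0 i; rewrite mem_index_enum => /(_ isT)/eqP.
have [i0 ri0] : exists i, r i != 0.
  apply/existsP; apply: contraT; rewrite negb_exists => /forallP r_eq0.
  move: r1; rewrite big1 => [/eqP|i _]; first by rewrite eq_sym oner_eq0.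
  by have := r_eq0 i; rewrite negbK => /eqP.
have ai0 : a i0 = s.
  by have /eqP := sr0 i0; rewrite mulf_eq0 (negbTE ri0) orbF subr_eq0 => /eqP.
have psi (k : nat) : (k <= n)%N ->
    exists2 psi : 'cV[C]_n.+1, psi != 0 & L 2 *m psi = (s - k%:R) *: psi.
  elim: k => [_|k IH kn].
    exists (col i0 (P^t*)) => //; have [-> _] := spectral_col i0 PP LE.
    by rewrite ai0 subr0.
  have [psi psi0 Lpsi] := IH (ltnW kn).
  have N1r : (- 1 : C) \is Num.real by rewrite realN.
  have N1s : (- 1 : C) ^+ 2 = 1 by rewrite sqrrN expr1n.
  exists (ladder (- 1) L *m psi).
    rewrite -cvec_normsq_eq0 (ladder_norm N1r N1s h Lpsi) mulf_eq0 cvec_normsq_eq0.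
    rewrite (negbTE psi0) orbF.
    (* The factor of [ladder_norm] at [mu = s - k]; it is nonzero as long as [k < n], so lowering
       does not stop before [- s]. *)
    rewrite (_ : _ - _ = (n - k)%:R * k.+1%:R); last first.
      by rewrite natrB 1?ltnW// -natr1; field.
    by rewrite mulf_neq0// pnatr_eq0// subn_eq0 -ltnNge.
  rewrite mulmxA (ladder_comm N1s h) mulmxDl -mulmxA Lpsi -scalemxAr -scalemxAl.
  by rewrite -scalerDl; congr (_ *: _); rewrite -[k.+1%:R]natr1; ring.
have f_ex (k : 'I_n.+1) : exists i, a i == s - k%:R.
  have [v v0 Lv] := psi k (ltn_ord k).
  have Pv0 : P *m v != 0.
    by apply: contra v0 => /eqP Pv; rewrite -(mul1mx v) -PP -mulmxA Pv mulmx0.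
  have [i vi] : exists i, (P *m v) i ord0 != 0.
    apply/existsP; apply: contraT; rewrite negb_exists => /forallP Pvi.
    case/eqP: Pv0; apply/colP => i; rewrite [RHS]mxE.
    by have := Pvi i; rewrite negbK => /eqP.
  exists i; have : diag_mx (\row_i a i) *m (P *m v) = (s - k%:R) *: (P *m v).
    have PL : P *m L 2 = diag_mx (\row_i a i) *m P by rewrite LE !mulmxA PPt mul1mx.
    by rewrite mulmxA -PL -mulmxA Lv scalemxAr.
  move/colP/(_ i); rewrite mul_diag_mx mxE [RHS]mxE [in LHS]mxE => /eqP.
  by rewrite -subr_eq0 -mulrBl mulf_eq0 (negbTE vi) orbF subr_eq0.
(* [f] picks an index for each of the [n + 1] eigenvalues found; as an injection of ['I_n.+1] into
   itself it is a bijection, hence [a] is injective. *)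
pose f k := xchoose (f_ex k).
have fE k : a (f k) = s - k%:R by apply/eqP; exact: (xchooseP (f_ex k)).
have f_inj : injective f.
  move=> k l kl; apply/val_inj/eqP; rewrite -(eqr_nat C); apply/eqP.
  by apply: (inv_inj (fun x => subKr s x)); rewrite -!fE kl.
have a_inj i j : a i = a j -> i = j.
  have [g fK gK] := injF_bij f_inj.
  rewrite -(gK i) -(gK j) !fE => /(inv_inj (fun x => subKr s x))/eqP.
  by rewrite eqr_nat => /eqP/val_inj ->.
have r_eq0 i : i != i0 -> r i = 0.
  move=> ii0; have /eqP := sr0 i; rewrite mulf_eq0 subr_eq0 -ai0 => /orP[/eqP/a_inj|/eqP//].
  by move=> /esym/eqP; rewrite (negbTE ii0).
have ri01 : r i0 = 1.
  by rewrite -r1 (bigD1 i0)//= big1 ?addr0// => i /r_eq0.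
(* All diagonal entries but one vanish, and [density_diag0] clears their rows and columns. *)
have PrP : P *m rho *m P^t* = delta_mx i0 ord0 *m delta_mx (ord0 : 'I_1) i0.
  rewrite mul_delta_mx; apply/matrixP => i j; rewrite [RHS]mxE.
  have [->|ii0] := eqVneq i i0; last first.
    by have [_ ->] := density_diag0 j hrho (etrans (rE i) (r_eq0 i ii0)).
  have [->|ji0] := eqVneq j i0; first by rewrite rE.
  by have [-> _] := density_diag0 i0 hrho (etrans (rE j) (r_eq0 j ji0)).
have [Lc c1] := spectral_col i0 PP LE.
exists (col i0 (P^t*)); split => //; first by rewrite Lc ai0.
rewrite colE adjmxM trmxCK trmx_delta map_delta_mx.
rewrite mulmxA -[X in X *m P]mulmxA -PrP !mulmxA PP mul1mx -mulmxA PP mulmx1.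
by [].
Qed.

End SpinHalfInteger.

(** * Integrals of powers *)

Section RealIntegrals.
Context {R : realType}.
Notation mu := (@lebesgue_measure R).
Implicit Types (f F G : R -> R) (a b x : R).

Lemma continuous_itv_integrable f a b : continuous f ->
  mu.-integrable `[a, b] (EFin \o f).
Proof.
move=> cf; apply: continuous_compact_integrable; first exact: segment_compact.
exact: continuous_subspaceT.
Qed.

Lemma Rintegral_derive F f a b : a <= b -> (forall x, is_derive x 1 F (f x)) ->
  continuous f -> (\int[mu]_(x in `[a, b]) f x)%R = F b - F a.
Proof.
rewrite le_eqVlt => /predU1P[<- _ _|ab dF cf].
  by rewrite set_itv1 Rintegral_set1 subrr.
have cF : continuous F.
  by move=> x; apply/differentiable_continuous/derivable1_diffP; have [] := dF x.
rewrite /Rintegral (@continuous_FTC2 _ f F)//.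
- exact: continuous_subspaceT.
- split; [by move=> x _; have [] := dF x| |].
  + by apply: cvg_at_right_filter; exact: cF.
  + by apply: cvg_at_left_filter; exact: cF.
- by move=> x _; rewrite derive1E; exact: derive_val.
Qed.

Lemma Rintegral_shift f a b t : a <= b -> continuous f ->
  (\int[mu]_(x in `[a, b]) f (x + t))%R = (\int[mu]_(x in `[a + t, b + t]) f x)%R.
Proof.
move=> ab cf; rewrite /Rintegral; congr fine.
have d1 x : is_derive x 1 (fun y : R => y + t) 1.
  by apply: is_derive_eq; rewrite addr0.
have d1E : (fun y : R => y + t)^`()%classic = fun=> 1.
  by apply/funext => x; rewrite derive1E; exact: derive_val.
have cadd : continuous (fun y : R => y + t).
  by move=> x; apply: cvgD; [exact: cvg_id|exact: cvg_cst].
rewrite (@integration_by_substitution_increasing _ (fun y => y + t) f a b)//.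
- by apply: eq_integral => x _; rewrite fctE /= d1E mulr1.
- by move=> x y _ _ xy; rewrite ltrD2r.
- by rewrite d1E => x _; exact: cvg_cst.
- by rewrite d1E; exact: is_cvg_cst.
- by rewrite d1E; exact: is_cvg_cst.
- split.
  + by move=> x _; have [] := d1 x.
  + by apply: cvg_at_right_filter; exact: cadd.
  + by apply: cvg_at_left_filter; exact: cadd.
- exact: continuous_subspaceT.
Qed.

Lemma Rintegral_split f a b c : a <= b -> b <= c -> continuous f ->
  (\int[mu]_(x in `[a, c]) f x)%R =
  (\int[mu]_(x in `[a, b]) f x)%R + (\int[mu]_(x in `[b, c]) f x)%R.
Proof.
move=> ab bc cf.
have := @Rintegral_itvB _ f (BLeft a) (BRight c) b (continuous_itv_integrable a c cf).
rewrite !bnd_simp => /(_ ab bc) /(canRL (subrK _)) ->.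
rewrite addrC Rintegral_itv_obnd_cbnd//.
apply: integrableS (continuous_itv_integrable b c cf) => //.
exact: subset_itv_oc_cc.
Qed.

(** The window [[t, h + t]] is cut at [h], and the piece beyond [h] is moved back by one period. *)
Lemma Rintegral_periodic f (h t : R) : 0 <= t <= h -> continuous f -> (forall x, f (x + h) = f x) ->
  (\int[mu]_(x in `[0%R, h]) f (x + t))%R = (\int[mu]_(x in `[0%R, h]) f x)%R.
Proof.
move=> /andP[t0 th] cf fh; have h0 := le_trans t0 th.
rewrite Rintegral_shift// add0r (@Rintegral_split f t h)//; last by rewrite lerDl.
rewrite (@Rintegral_split f 0 t h)// addrC; congr (_ + _).
have := @Rintegral_shift f 0 t h t0 cf; rewrite add0r (addrC t) => <-.
by apply: eq_Rintegral => x _; rewrite fh.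
Qed.

End RealIntegrals.

(** * Wallis-type recursions for integrals of products of powers of sine and cosine *)

Section TrigIntegrals.
Context {R : realType}.
Notation mu := (@lebesgue_measure R).

Definition trig_int (h : R) (m c : nat) : R :=
  (\int[mu]_(x in `[0%R, h]) (sin x ^+ m * cos x ^+ c))%R.

Lemma continuous_trig (m c : nat) : continuous (fun x : R => sin x ^+ m * cos x ^+ c).
Proof.
move=> x; apply: cvgM.
- apply: (@continuous_comp _ _ _ sin (fun y : R => y ^+ m)); first exact: continuous_sin.
  exact: exprn_continuous.
- apply: (@continuous_comp _ _ _ cos (fun y : R => y ^+ c)); first exact: continuous_cos.
  exact: exprn_continuous.
Qed.

Lemma is_derive_trig (m c : nat) (x : R) :
  is_derive x 1 (fun y => sin y ^+ m.+1 * cos y ^+ c)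
    (m.+1%:R * (sin x ^+ m * cos x ^+ c.+1) - c%:R * (sin x ^+ m.+2 * cos x ^+ c.-1)).
Proof.
have -> : (fun y => sin y ^+ m.+1 * cos y ^+ c) = ((@sin R) ^+ m.+1 * (@cos R) ^+ c).
  by rewrite !exprfctE.
apply: is_derive_eq; rewrite !exprfctE /GRing.scale/= !exprS.
by case: c => [|c]; rewrite /= ?mulr0n; ring.
Qed.

Section Recursion.
Context {h : R}.
Hypothesis h0 : 0 <= h.
Hypothesis sinh : sin h = 0.

(** Integration of the derivative in [is_derive_trig]; the boundary terms vanish because [sin] does
    at [0] and [h], which will be [pi] or [2 * pi]. For [c = 0] the truncated [c.-1] is harmless,
    its coefficient being [0]. *)
Lemma trig_int_parts m c :
  m.+1%:R * trig_int h m c.+1 = c%:R * trig_int h m.+2 c.-1.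
Proof.
apply/eqP; rewrite -subr_eq0; apply/eqP.
rewrite /trig_int -!RintegralZl//; [|exact/continuous_itv_integrable/continuous_trig..].
rewrite -RintegralB//; last 2 first.
- apply: continuous_itv_integrable => x.
  by apply: cvgM; [exact: cvg_cst|exact: continuous_trig].
- apply: continuous_itv_integrable => x.
  by apply: cvgM; [exact: cvg_cst|exact: continuous_trig].
rewrite (Rintegral_derive h0 (is_derive_trig m c)).
- by rewrite sinh sin0 !expr0n/= !mul0r subrr.
- move=> x; apply: cvgB; apply: cvgM; [exact: cvg_cst|exact: continuous_trig|
    exact: cvg_cst|exact: continuous_trig].
Qed.

Lemma trig_int_split m c : trig_int h m c = trig_int h m.+2 c + trig_int h m c.+2.
Proof.
rewrite /trig_int -RintegralD//; [|exact/continuous_itv_integrable/continuous_trig..].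
apply: eq_Rintegral => x _.
rewrite -[LHS]mulr1 -(cos2Dsin2 x) !exprS; ring.
Qed.

Lemma trig_int_cosS m c :
  (m + c + 2)%:R * trig_int h m c.+2 = c.+1%:R * trig_int h m c.
Proof.
have := trig_int_parts m c.+1; have := trig_int_split m c.
rewrite /= => -> e; rewrite mulrDr -e -mulrDl -natrD.
by congr (_%:R * _); rewrite addn2 addSn addnS.
Qed.

Lemma trig_int_sinS m c :
  (m + c + 2)%:R * trig_int h m.+2 c = m.+1%:R * trig_int h m c.
Proof.
have := trig_int_parts m c.+1; have := trig_int_split m c.
rewrite /= => -> e; rewrite mulrDr e -mulrDl -natrD.
by congr (_%:R * _); rewrite addn2 addSn addnS.
Qed.

Lemma trig_int_cos1 m : trig_int h m 1 = 0.
Proof.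
have /eqP := trig_int_parts m 0.
by rewrite mul0r mulf_eq0 pnatr_eq0/= => /eqP.
Qed.

(** The primitive is a power of [cos], equal at both ends when [cos h = 1]; this serves the azimuth,
    [h = 2 * pi]. *)
Lemma trig_int_sin1 c : cos h = 1 -> trig_int h 1 c = 0.
Proof.
move=> cosh.
have d (x : R) : is_derive x (1 : R) (fun y : R => - (c.+1%:R^-1 * cos y ^+ c.+1)) ((sin x ^+ 1 * cos x ^+ c) : R).
  have -> : (fun y : R => - (c.+1%:R^-1 * cos y ^+ c.+1)) = - (c.+1%:R^-1 \*: (@cos R) ^+ c.+1).
    by apply/funext => y; rewrite exprfctE.
  apply: is_derive_eq; rewrite /GRing.scale/= expr1.
  by field; rewrite addrC natr1 pnatr_eq0.
rewrite /trig_int (Rintegral_derive h0 d); last exact: continuous_trig.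
by rewrite cosh cos0 subrr.
Qed.

End Recursion.

End TrigIntegrals.

(** * Uniform approximation of Lipschitz functions by Bernstein polynomials *)

Section Bernstein.
Context {R : realType}.
Implicit Types (f : nat -> R) (x : R).

(* The Bernstein polynomial \sum_k f k 'C(N, k) 'X^k (1 - 'X)^(N - k), i.e. the
   expectation of f under the binomial law, defined by conditioning on the
   first of the N trials. *)
Fixpoint bernstein N f : {poly R} :=
  if N is N'.+1 then 'X * bernstein N' (fun k => f k.+1) + (1 - 'X) * bernstein N' f
  else (f 0%N)%:P.

Lemma bernsteinS N f x : (bernstein N.+1 f).[x] =
  x * (bernstein N (fun k => f k.+1)).[x] + (1 - x) * (bernstein N f).[x].
Proof. by rewrite /= !hornerE. Qed.

Lemma bernstein_le N f g x : 0 <= x <= 1 -> (forall k, (k <= N)%N -> f k <= g k) ->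
  (bernstein N f).[x] <= (bernstein N g).[x].
Proof.
move=> /andP[x0 x1]; elim: N f g => [|N IH] f g fg.
  by rewrite /= !hornerE fg.
rewrite !bernsteinS lerD// ler_wpM2l ?subr_ge0// IH// => k kN.
- exact: fg.
- by apply: fg; exact: leqW.
Qed.

Lemma bernstein_lin N f g (a b : R) x :
  (bernstein N (fun k => a * f k + b * g k)).[x] =
  a * (bernstein N f).[x] + b * (bernstein N g).[x].
Proof.
elim: N f g => [|N IH] f g; first by rewrite /= !hornerE.
by rewrite !bernsteinS !IH; ring.
Qed.

Lemma bernstein_cst N (a : R) x : (bernstein N (fun=> a)).[x] = a.
Proof. by elim: N => [|N IH]; [rewrite /= hornerE|rewrite bernsteinS IH; ring]. Qed.

(** Squared bias plus variance of the binomial law. The centre [c] is arbitrary for the sake of the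
    induction: a success in the first trial turns [c] into [c - 1]. *)
Lemma bernstein_variance N (c : R) x : (bernstein N (fun k => (k%:R - c) ^+ 2)).[x] =
  (N%:R * x - c) ^+ 2 + N%:R * (x * (1 - x)).
Proof.
elim: N c => [|N IH] c; first by rewrite /= hornerE; ring.
rewrite bernsteinS IH (_ : (fun k => _) = fun k => (k%:R - (c - 1)) ^+ 2); last first.
  by apply/funext => k; rewrite -natr1; ring.
by rewrite IH -natr1; ring.
Qed.

(** Bernstein's argument: the Lipschitz bound on the error at [k / M] is majorised by a quadratic in
    [k], whose binomial expectation is known. *)
Lemma lipschitz_approx (h : R -> R) (K : R) : 0 <= K ->
  (forall x y, 0 <= x <= 1 -> 0 <= y <= 1 -> `|h x - h y| <= K * `|x - y|) ->
  forall e, 0 < e -> exists P : {poly R}, forall x, 0 <= x <= 1 -> `|P.[x] - h x| <= e.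
Proof.
move=> K0 hK e e0.
pose d := e / (K + 1).
have K1 : 0 < K + 1 by rewrite ltr_wpDl.
have d0 : 0 < d by rewrite divr_gt0.
have [N] : exists N : nat, (d ^- 2) < N.+1%:R.
  by exists (Num.truncn (d ^- 2)); exact: truncnS_gt.
set M := N.+1 => dN.
have M0 : 0 < M%:R :> R by rewrite ltr0n.
exists (bernstein M (fun k => h (k%:R / M%:R))) => x x01.
(* [b k] is [K (d + t^2 / d) / 2] with [t = |k/M - x|], at least [K t] by the arithmetic-geometric
   inequality. Its expectation is at most [K d] since [M > d ^- 2], and [K d <= e] by the choice
   [d = e / (K + 1)]. *)
pose b (k : nat) : R := K / 2 * d + (K / (2 * d * M%:R ^+ 2)) * (k%:R - M%:R * x) ^+ 2.
have hb (k : nat) : (k <= M)%N -> `|h (k%:R / M%:R) - h x| <= b k.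
  move=> kM; apply: (le_trans (hK _ _ _ x01)).
    by rewrite divr_ge0//= ler_pdivrMr// mul1r ler_nat.
  have -> : b k = K * ((d + `|k%:R / M%:R - x| ^+ 2 / d) / 2).
    rewrite /b real_normK ?num_real//; field.
    by rewrite (gt_eqF d0) (gt_eqF M0).
  apply: ler_wpM2l => //; rewrite ler_pdivlMr// -subr_ge0.
  set t := `|_|.
  rewrite (_ : _ - _ = (d - t) ^+ 2 / d); last by field; rewrite gt_eqF.
  by rewrite divr_ge0 ?sqr_ge0 ?ltW.
have bE : (bernstein M b).[x] <= e.
  have -> : (bernstein M b).[x] = K / 2 * d + K / (2 * d * M%:R ^+ 2) * (M%:R * (x * (1 - x))).
    have := bernstein_lin M (fun=> 1) (fun k => (k%:R - M%:R * x) ^+ 2) (K / 2 * d)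
      (K / (2 * d * M%:R ^+ 2)) x.
    rewrite bernstein_cst bernstein_variance subrr expr0n/= add0r mulr1 => <-.
    by congr (bernstein M _).[x]; apply/funext => k; rewrite mulr1.
  have -> : K / (2 * d * M%:R ^+ 2) * (M%:R * (x * (1 - x))) =
      (K / 2 * d) * ((x * (1 - x)) * (d ^- 2 / M%:R)).
    by field; rewrite (gt_eqF d0) (gt_eqF M0).
  have c1 : (x * (1 - x)) * (d ^- 2 / M%:R) <= 1.
    case/andP: x01 => x0 x1.
    rewrite -[leRHS]mulr1 ler_pM//.
    - by rewrite mulr_ge0// subr_ge0.
    - by apply: divr_ge0; rewrite ?invr_ge0 ?exprn_ge0// ltW.
    - by rewrite -[leRHS]mulr1 ler_pM ?subr_ge0// lerBlDr lerDl.
    - by rewrite ler_pdivrMr// mul1r ltW.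
  have Kd : 0 <= K / 2 * d by rewrite mulr_ge0 ?divr_ge0// ltW.
  apply: (@le_trans _ _ (K / 2 * d + K / 2 * d)).
    by rewrite lerD2l -[leRHS]mulr1 ler_wpM2l.
  rewrite -mulrDl -splitr /d mulrA ler_pdivrMr// mulrC ler_pM2l//.
  by rewrite lerDl.
have up (a : R) : (a = 1) \/ (a = - 1) ->
    a * ((bernstein M (fun k => h (k%:R / M%:R))).[x] - h x) <= e.
  move=> a1; apply: le_trans bE.
  have -> : a * ((bernstein M (fun k => h (k%:R / M%:R))).[x] - h x) =
      (bernstein M (fun k => a * h (k%:R / M%:R) + (- a * h x) * 1)).[x].
    by rewrite bernstein_lin bernstein_cst; ring.
  apply: bernstein_le => // k /hb; apply: le_trans.
  apply: le_trans (ler_norm _) _.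
  rewrite mulr1 mulNr -mulrBr normrM.
  by case: a1 => ->; rewrite ?normrN normr1 mul1r.
have u1 := up 1 (or_introl erefl); have uN := up (- 1) (or_intror erefl).
by rewrite ler_norml lerNl -mulN1r uN; rewrite mul1r in u1.
Qed.

End Bernstein.

(** * Inequalities and continuity for real powers *)

Section PowerFunction.
Context {R : realType}.
Implicit Types (x y p : R).

(** A constant without derivatives: for an integer [k >= p] and [t = y / x] in [[0, 1]], Bernoulli's
    inequality gives [1 - t^p <= 1 - t^k <= k (1 - t)], and [x^p <= x]. *)
Lemma powR_lipschitz01 p : 1 <= p -> exists2 K : R, 0 <= K &
  forall x y, 0 <= x <= 1 -> 0 <= y <= 1 -> `|x `^ p - y `^ p| <= K * `|x - y|.
Proof.
move=> p1; have p0 : 0 < p := lt_le_trans ltr01 p1.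
pose k := (Num.truncn p).+1.
have pk : p <= k%:R by rewrite ltW// truncnS_gt.
have main x y : 0 <= y <= x -> x <= 1 -> x `^ p - y `^ p <= k%:R * (x - y).
  move=> /andP[y0 yx] x1; have x0 := le_trans y0 yx.
  have [e|xn0] := eqVneq x 0.
    have -> : y = 0 by apply/eqP; rewrite eq_le y0 andbT (le_trans yx)// -e.
    by rewrite e !subrr mulr0.
  have xp : 0 < x by rewrite lt_def xn0.
  pose t := y / x.
  have t01 : 0 <= t <= 1 by rewrite divr_ge0//= ler_pdivrMr// mul1r.
  have yE : y = x * t by rewrite /t mulrC divfK.
  case/andP: (t01) => t0 t1.
  have tk : 1 - k%:R * (1 - t) <= t `^ p.
    apply: (@le_trans _ _ (t ^+ k)).
      have B m : 1 - m%:R * (1 - t) <= t ^+ m.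
        elim: m => [|m IH]; first by rewrite mul0r subr0 expr0.
        rewrite exprS; apply: le_trans (ler_wpM2l t0 IH).
        rewrite -subr_ge0 -natr1.
        rewrite (_ : _ - _ = m%:R * (1 - t) ^+ 2); last by ring.
        by rewrite mulr_ge0// sqr_ge0.
      exact: B.
    rewrite -powR_mulrn//.
    have [->|tn0] := eqVneq t 0; first by rewrite !powR0// ?gt_eqF// pnatr_eq0.
    by apply: ger_powR => //; rewrite t1 andbT lt_def tn0.
  rewrite yE powRM// -[leLHS](_ : x `^ p * (1 - t `^ p) = _); last by ring.
  apply: (@le_trans _ _ (x * (k%:R * (1 - t)))); last by rewrite le_eqVlt; apply/orP; left; apply/eqP; ring.
  apply: ler_pM; rewrite ?powR_ge0 ?subr_ge0//.
  - have := @ge0_ler_powR _ p (ltW p0) t 1; rewrite powR1 /=; apply => //; rewrite ?nnegrE//.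
  - by rewrite ge1r_powR// xp.
  - by rewrite lerBlDr -lerBlDl.
exists k%:R => // x y /andP[x0 x1] /andP[y0 y1].
wlog yx : x y x0 x1 y0 y1 / y <= x.
  move=> H; have [|/ltW] := leP y x; first exact: H.
  by move=> xy; rewrite distrC (distrC x); exact: H.
rewrite (ger0_norm (_ : 0 <= x - y)) ?subr_ge0// ger0_norm ?subr_ge0; last first.
  by apply: ge0_ler_powR; rewrite ?nnegrE// ltW.
by apply: main; rewrite ?y0.
Qed.

(** The ratios of [x] and [y] to [x + y] lie in [[0, 1]], where a power with exponent [p >= 1] only
    decreases them, and they add up to [1]. *)
Lemma powR_superadditive p x y : 1 <= p -> 0 <= x -> 0 <= y ->
  x `^ p + y `^ p <= (x + y) `^ p.
Proof.
move=> p1 x0 y0; have p0 : 0 < p := lt_le_trans ltr01 p1.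
have [xy|xyn0] := eqVneq (x + y) 0.
  move/eqP: xy; rewrite paddr_eq0// => /andP[/eqP -> /eqP ->].
  by rewrite !addr0 powR0 ?gt_eqF// addr0.
have xy0 : 0 < x + y by rewrite lt_def xyn0 addr_ge0.
have part z : 0 <= z -> z <= x + y -> z `^ p <= (x + y) `^ p * (z / (x + y)).
  move=> z0 zxy; have {1}-> : z = (x + y) * (z / (x + y)) by rewrite mulrC divfK.
  rewrite powRM ?divr_ge0 ?addr_ge0// ler_wpM2l ?powR_ge0//.
  have [->|zn0] := eqVneq z 0; first by rewrite mul0r powR0// gt_eqF.
  apply: ge1r_powR => //; apply/andP; split; last by rewrite ler_pdivrMr// mul1r.
  by rewrite divr_gt0// lt_def zn0.
have hx : x <= x + y by rewrite lerDl.
have hy : y <= x + y by rewrite lerDr.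
apply: le_trans (lerD (part _ x0 hx) (part _ y0 hy)) _.
by rewrite -mulrDr -mulrDl divff// mulr1.
Qed.

Lemma powR_midpoint p x y : 1 <= p -> 0 <= x -> 0 <= y ->
  ((x + y) / 2) `^ p <= (x `^ p + y `^ p) / 2.
Proof.
move=> p1 x0 y0.
have h : (0 <= 2^-1 :> R) && (2^-1 <= 1 :> R) by apply/andP; split; lra.
have := @convex_powR R p p1 (Itv01 (andP h).1 (andP h).2) x y.
rewrite !inE /= !in_itv/= !andbT => /(_ x0 y0).
rewrite convRE [X in X `^ _ <= _ -> _]convRE /= /unstable.onem.
have -> : 1 - 2^-1 = 2^-1 :> R by lra.
by rewrite -!mulrDr !(mulrC 2^-1).
Qed.

(** The absolute value gives a function continuous on the whole line, ready to be composed with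
    globally continuous maps. At [0] it is squeezed by [|x|^p <= |x|]. *)
Lemma continuous_abs_powR p : 1 <= p -> continuous (fun x : R => `|x| `^ p).
Proof.
move=> p1 x; have p0 : 0 < p := lt_le_trans ltr01 p1.
have [->|xn0] := eqVneq x 0.
  rewrite /continuous_at normr0 powR0 ?gt_eqF//.
  apply/cvgr0Pnorm_lt => e e0.
  near=> t; rewrite ger0_norm ?powR_ge0//.
  have t1 : `|t| <= 1 by near: t; apply: (@nbhs0_le _ R^o) => //.
  have te : `|t| < e by near: t; exact: (@nbhs0_lt _ R^o).
  apply: le_lt_trans te.
  have [->|tn0] := eqVneq t 0; first by rewrite normr0 powR0 ?gt_eqF.
  by rewrite ge1r_powR// normr_gt0 tn0.
apply: (@continuous_comp _ _ _ (fun y : R => `|y|) (fun y : R => y `^ p)).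
  exact: norm_continuous.
apply: differentiable_continuous; apply/derivable1_diffP.
by apply: derivable_powR; rewrite in_itv/= andbT normr_gt0.
Unshelve. all: by end_near. Qed.

End PowerFunction.

(** * Rotation invariance of the sphere integral *)

Section SphereIntegral.
Context {R : realType}.
Notation mu := (@lebesgue_measure R).
Implicit Types (f g : 'rV[R]_3 -> R) (e : 'rV[R]_3).

Definition row3 (x y z : R) : 'rV[R]_3 := \row_j [:: x; y; z]`_j.

Lemma row3E (x y z : R) :
  (row3 x y z ord0 0 = x) * (row3 x y z ord0 1 = y) * (row3 x y z ord0 2 = z).
Proof. by rewrite /row3 !mxE. Qed.

Lemma row3_eta e : e = row3 (e ord0 0) (e ord0 1) (e ord0 2).
Proof.
apply/rowP => -[[|[|[|//]]] hj]; rewrite mxE /=; congr (e _ _); exact: val_inj.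
Qed.

Lemma continuous_row3 (T : topologicalType) (a b c : T -> R) :
  continuous a -> continuous b -> continuous c ->
  continuous (fun t => row3 (a t) (b t) (c t)).
Proof.
move=> ca cb cc t A [P hP PA].
have H i j : \forall x \near t, P i j (row3 (a x) (b x) (c x) i j).
  move: (hP i j); case: j => -[|[|[|//]]] hj h; rewrite mxE /= in h;
    near=> x; rewrite mxE /=; near: x; [exact: (ca t _ h)|exact: (cb t _ h)|exact: (cc t _ h)].
have HH : \forall x \near t, forall i j, P i j (row3 (a x) (b x) (c x) i j).
  by apply: filter_forall => i; apply: filter_forall => j; exact: H.
near=> x; apply: PA => i j; move: i j; near: x; exact: HH.
Unshelve. all: by end_near. Qed.

Lemma continuous_sph_theta (phi : R) : continuous (fun theta => sph theta phi).
Proof.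
apply: continuous_row3.
- by move=> x; apply: cvgM; [exact: continuous_sin|exact: cvg_cst].
- by move=> x; apply: cvgM; [exact: continuous_sin|exact: cvg_cst].
- exact: continuous_cos.
Qed.

Lemma continuous_sph_phi (theta : R) : continuous (fun phi => sph theta phi).
Proof.
apply: continuous_row3.
- by move=> x; apply: cvgM; [exact: cvg_cst|exact: continuous_cos].
- by move=> x; apply: cvgM; [exact: cvg_cst|exact: continuous_sin].
- by move=> x; exact: cvg_cst.
Qed.

Lemma sphE (theta phi : R) : sph theta phi =
  row3 (sin theta * cos phi) (sin theta * sin phi) (cos theta).
Proof. by []. Qed.

Lemma sphere2E e : sphere2 e <-> e ord0 0 ^+ 2 + e ord0 1 ^+ 2 + e ord0 2 ^+ 2 = 1.
Proof. by rewrite /sphere2/= sum3. Qed.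

Lemma sphere2_sph (theta phi : R) : sphere2 (sph theta phi).
Proof.
apply/sphere2E; rewrite sphE !row3E !exprMn -mulrDr cos2Dsin2 mulr1 addrC.
exact: cos2Dsin2.
Qed.

Lemma sphere_bounded f : continuous f ->
  exists K, forall e, sphere2 e -> `|f e| <= K.
Proof.
move=> cf; have [e1 [_ _ h1]] := sphere_max cf.
have cNf : continuous (fun e => - f e) by move=> e; apply: (@cvgN _ _ _ (nbhs e)); exact: cf.
have [e2 [_ _ h2]] := sphere_max cNf.
exists (Num.max (f e1) (- f e2)) => e he.
rewrite ler_norml lerNl !le_max; apply/andP; split.
- by rewrite h2// orbT.
- by rewrite h1.
Qed.

Definition theta_int f (phi : R) : R :=
  (\int[mu]_(theta in `[0%R, pi]) (f (sph theta phi) * sin theta))%R.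

Lemma continuous_theta f (phi : R) : continuous f ->
  continuous (fun theta => f (sph theta phi) * sin theta).
Proof.
move=> cf x; apply: cvgM; last exact: continuous_sin.
by apply: continuous_comp; [exact: continuous_sph_theta|exact: cf].
Qed.

(** Dominated convergence, with a bound of [|f|] on the sphere as the majorant. *)
Lemma continuous_theta_int f : continuous f -> continuous (theta_int f).
Proof.
move=> cf phi; have [K hK] := sphere_bounded cf.
have := @continuity_under_integral R _ _ mu (fun phi theta => f (sph theta phi) * sin theta)
  `[0, pi]%classic (measurable_itv _) (phi - 1) (phi + 1).
move=> /(_ _ _ (fun=> K)); apply.
- by move=> x _; exact/continuous_itv_integrable/continuous_theta.
- apply: aeW => theta _ x _; apply: cvgM; last exact: cvg_cst.
  by apply: continuous_comp; [exact: continuous_sph_phi|exact: cf].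
- by apply: continuous_itv_integrable => x; exact: cvg_cst.
- move=> x _; apply: aeW => theta _.
  rewrite normrM -[leRHS]mulr1 ler_pM//; last exact: sin_max.
  by apply: hK; exact: sphere2_sph.
- by rewrite inE/= in_itv/= ltrBlDr ltrDl ltr01.
Qed.

Lemma sphere_intE f : sphere_int f = (\int[mu]_(phi in `[0%R, (2 * pi)%R]) theta_int f phi)%R.
Proof. by []. Qed.

Lemma eq_sphere_int f g : (forall e, sphere2 e -> f e = g e) -> sphere_int f = sphere_int g.
Proof.
move=> fg; apply: eq_Rintegral => phi _; apply: eq_Rintegral => theta _.
by rewrite fg//; exact: sphere2_sph.
Qed.

Lemma sphere_intD f g : continuous f -> continuous g ->
  sphere_int (fun e => f e + g e) = sphere_int f + sphere_int g.
Proof.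
move=> cf cg; rewrite !sphere_intE -RintegralD//; last 2 first.
- exact/continuous_itv_integrable/continuous_theta_int.
- exact/continuous_itv_integrable/continuous_theta_int.
apply: eq_Rintegral => phi _; rewrite /theta_int -RintegralD//; last 2 first.
- exact/continuous_itv_integrable/continuous_theta.
- exact/continuous_itv_integrable/continuous_theta.
by apply: eq_Rintegral => theta _; rewrite mulrDl.
Qed.

Lemma sphere_intZ (c : R) f : continuous f ->
  sphere_int (fun e => c * f e) = c * sphere_int f.
Proof.
move=> cf; rewrite !sphere_intE -RintegralZl//; last first.
  exact/continuous_itv_integrable/continuous_theta_int.
apply: eq_Rintegral => phi _; rewrite /theta_int -RintegralZl//; last first.
  exact/continuous_itv_integrable/continuous_theta.
by apply: eq_Rintegral => theta _; rewrite mulrA.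
Qed.

Lemma le_sphere_int f g : continuous f -> continuous g ->
  (forall e, sphere2 e -> f e <= g e) -> sphere_int f <= sphere_int g.
Proof.
move=> cf cg fg; rewrite !sphere_intE; apply: le_Rintegral => //.
- exact/continuous_itv_integrable/continuous_theta_int.
- exact/continuous_itv_integrable/continuous_theta_int.
move=> phi _; apply: le_Rintegral => //.
- exact/continuous_itv_integrable/continuous_theta.
- exact/continuous_itv_integrable/continuous_theta.
move=> theta /=; rewrite in_itv/= => h.
by rewrite ler_wpM2r ?sin_ge0_pi// fg//; exact: sphere2_sph.
Qed.

Lemma sphere_int_cst (c : R) : sphere_int (fun=> c) = c * (4 * pi).
Proof.
have thetaE phi : theta_int (fun=> c) phi = c * 2.
  have d (x : R) : is_derive x (1 : R) (- cos : R -> R) (sin x : R).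
    by apply: is_derive_eq; rewrite opprK.
  rewrite /theta_int RintegralZl//; last exact/continuous_itv_integrable/continuous_sin.
  rewrite (Rintegral_derive (pi_ge0 R) d); last exact: continuous_sin.
  by rewrite !fctE cospi cos0 opprK -[1 + 1]/(2 : R).
rewrite sphere_intE (_ : theta_int (fun=> c) = fun=> c * 2); last exact/funext.
have d (x : R) : is_derive x (1 : R) ((c * 2) \*: (@id R)) ((c * 2) : R).
  by apply: is_derive_eq; rewrite /GRing.scale/= mulr1.
rewrite (Rintegral_derive _ d); last by move=> x; exact: cvg_cst.
- have E x : ((c * 2) \*: (@id R)) x = c * 2 * x by [].
  by rewrite !E; ring.
- by rewrite mulr_ge0// pi_ge0.
Qed.

(** The rotation about the third axis by the angle of cosine [u] and sine [w]. Keeping the pair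
    instead of the angle makes quarter turns and normalised coordinates directly available. *)
Definition rotz (u w : R) e : 'rV[R]_3 :=
  row3 (u * e ord0 0 - w * e ord0 1) (w * e ord0 0 + u * e ord0 1) (e ord0 2).

Definition cyc e : 'rV[R]_3 := row3 (e ord0 2) (e ord0 0) (e ord0 1).

Lemma continuous_rotz u w : continuous (rotz u w).
Proof.
apply: continuous_row3 => [e|e|]; last exact: coord_continuous.
- apply: (@cvgB _ _ _ (nbhs e)); apply: (@cvgM _ _ (nbhs e));
    [exact: cvg_cst|exact: coord_continuous|exact: cvg_cst|exact: coord_continuous].
- apply: (@cvgD _ _ _ (nbhs e)); apply: (@cvgM _ _ (nbhs e));
    [exact: cvg_cst|exact: coord_continuous|exact: cvg_cst|exact: coord_continuous].
Qed.

Lemma continuous_cyc : continuous cyc.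
Proof. by apply: continuous_row3; exact: coord_continuous. Qed.

Lemma sphere2_rotz u w e : u ^+ 2 + w ^+ 2 = 1 -> sphere2 e -> sphere2 (rotz u w e).
Proof.
move=> uw /sphere2E he; apply/sphere2E; rewrite /rotz !row3E -he.
transitivity ((u ^+ 2 + w ^+ 2) * (e ord0 0 ^+ 2 + e ord0 1 ^+ 2) + e ord0 2 ^+ 2).
  by ring.
by rewrite uw mul1r.
Qed.

Lemma sphere2_cyc e : sphere2 e -> sphere2 (cyc e).
Proof.
by move=> /sphere2E he; apply/sphere2E; rewrite /cyc !row3E -he; ring.
Qed.

(** [acos u] when [w] is nonnegative, its reflection [2 * pi - acos u] otherwise; the range is the
    one required by [Rintegral_periodic]. *)
Lemma circle_angle (u w : R) : u ^+ 2 + w ^+ 2 = 1 ->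
  exists2 t : R, 0 <= t <= 2 * pi & cos t = u /\ sin t = w.
Proof.
move=> uw.
have u1 : -1 <= u <= 1.
  by rewrite -ler_norml -(@ler_pXn2r _ 2)// ?nnegrE// expr1n real_normK ?num_real// -uw
    lerDl sqr_ge0.
have ca : cos (acos u) = u by rewrite acosK.
have sa : sin (acos u) = `|w|.
  rewrite sin_acos// (_ : 1 - u ^+ 2 = w ^+ 2); last by rewrite -uw; ring.
  exact: sqrtr_sqr.
have a0 : 0 <= acos u by exact: acos_ge0.
have api : acos u <= pi by exact: acos_lepi.
have p0 := pi_ge0 R.
have [w0|w0] := leP 0 w.
  exists (acos u); last by rewrite sa ger0_norm.
  by rewrite a0/= (le_trans api)// mulr_natl mulr2n lerDl.
exists (2 * pi - acos u).
  by apply/andP; split; lra.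
rewrite -[2 * pi - _]opprB cosN sinN mulr_natl.
split.
  by rewrite -(cosD2pi (acos u - _)) subrK.
by rewrite -(sinD2pi (acos u - _)) subrK sa ltr0_norm// opprK.
Qed.

(** The rotation adds a constant to the azimuth, of which [theta_int f] is a function of period
    [2 * pi]. *)
Lemma sphere_int_rotz (u w : R) f : u ^+ 2 + w ^+ 2 = 1 -> continuous f ->
  sphere_int (f \o rotz u w) = sphere_int f.
Proof.
move=> uw cf; have [t t2pi [tu tw]] := circle_angle uw.
rewrite !sphere_intE -[RHS](Rintegral_periodic t2pi (continuous_theta_int cf)).
  apply: eq_Rintegral => phi _; apply: eq_Rintegral => theta _ /=; congr (f _ * _).
  rewrite !sphE /rotz !row3E cosD sinD tu tw.
  by congr row3; ring.
move=> phi; apply: eq_Rintegral => theta _.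
by rewrite !sphE mulr_natl cosD2pi sinD2pi.
Qed.

End SphereIntegral.

(** * Invariance under the cyclic permutation of the coordinates *)

Section CyclicInvariance.
Context {R : realType}.
Implicit Types (f g : 'rV[R]_3 -> R) (e : 'rV[R]_3).

(* The moments of the sphere satisfy a recursion that is symmetric in the three
   coordinates, hence are invariant under permutations of these. *)
Lemma moment_recursion_uniq (M N : nat -> nat -> nat -> R) :
  (forall a b c, (a + b + c + 3)%:R * M a.+2 b c = a.+1%:R * M a b c) ->
  (forall a b c, (a + b + c + 3)%:R * M a b.+2 c = b.+1%:R * M a b c) ->
  (forall a b c, (a + b + c + 3)%:R * M a b c.+2 = c.+1%:R * M a b c) ->
  (forall b c, M 1%N b c = 0) -> (forall a c, M a 1%N c = 0) -> (forall a b, M a b 1%N = 0) ->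
  (forall a b c, (a + b + c + 3)%:R * N a.+2 b c = a.+1%:R * N a b c) ->
  (forall a b c, (a + b + c + 3)%:R * N a b.+2 c = b.+1%:R * N a b c) ->
  (forall a b c, (a + b + c + 3)%:R * N a b c.+2 = c.+1%:R * N a b c) ->
  (forall b c, N 1%N b c = 0) -> (forall a c, N a 1%N c = 0) -> (forall a b, N a b 1%N = 0) ->
  M 0%N 0%N 0%N = N 0%N 0%N 0%N -> forall a b c, M a b c = N a b c.
Proof.
move=> Ma Mb Mc M1 M2 M3 Na Nb Nc N1 N2 N3 MN.
have ind2 (P : nat -> Prop) : P 0%N -> P 1%N -> (forall k, P k -> P k.+2) -> forall k, P k.
  move=> P0 P1 PS k; suff : P k /\ P k.+1 by case.
  by elim: k => [|k [Pk Pk1]]; split => //; exact: PS.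
have can (k l : nat) (x y x' y' : R) : (k + 3)%:R * x' = l%:R * x ->
    (k + 3)%:R * y' = l%:R * y -> x = y -> x' = y'.
  move=> hx hy xy; have k0 : (k + 3)%:R != 0 :> R by rewrite pnatr_eq0 addn3.
  by apply: (mulfI k0); rewrite hx hy xy.
elim/ind2 => [|b c|a IH b c]; last 1 first.
- exact: (can (a + b + c)%N a.+1 _ _ _ _ (Ma _ _ _) (Na _ _ _)).
- elim/ind2 => [|c|b IH c]; last 1 first.
  + exact: (can (0 + b + c)%N b.+1 _ _ _ _ (Mb _ _ _) (Nb _ _ _)).
  + elim/ind2 => [//||c IH]; first by rewrite M3 N3.
    exact: (can (0 + 0 + c)%N c.+1 _ _ _ _ (Mc _ _ _) (Nc _ _ _)).
  + by rewrite M2 N2.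
- by rewrite M1 N1.
Qed.

Definition monom (a b c : nat) e : R := e ord0 0 ^+ a * e ord0 1 ^+ b * e ord0 2 ^+ c.

Lemma continuous_monom a b c : continuous (monom a b c).
Proof.
have cX j k : continuous (fun e : 'rV[R]_3 => e ord0 j ^+ k).
  move=> e; apply: (@continuous_comp _ _ _ (fun e : 'rV[R]_3 => e ord0 j) (fun x : R => x ^+ k)).
    exact: coord_continuous.
  exact: exprn_continuous.
move=> e; apply: (@cvgM _ _ (nbhs e)); last exact: cX.
by apply: (@cvgM _ _ (nbhs e)); exact: cX.
Qed.

(** Polar coordinates separate the integral of [x^a y^b z^c]; the [+ 1] in the power of the sine is
    the area element. *)
Let moment a b c : R := trig_int pi (a + b + 1) c * trig_int (2 * pi) b a.

Lemma sphere_int_monom a b c : sphere_int (monom a b c) = moment a b c.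
Proof.
have cS : continuous (fun phi : R => sin phi ^+ b * cos phi ^+ a) by exact: continuous_trig.
rewrite sphere_intE (_ : theta_int (monom a b c) =
    fun phi => trig_int pi (a + b + 1) c * (sin phi ^+ b * cos phi ^+ a)).
  by rewrite RintegralZl//; exact: continuous_itv_integrable.
apply/funext => phi; rewrite /theta_int mulrC /trig_int -RintegralZl//; last first.
  exact/continuous_itv_integrable/continuous_trig.
apply: eq_Rintegral => theta _.
by rewrite sphE /monom !row3E !exprMn !exprD expr1; ring.
Qed.

Lemma sphere_int_monom_cyc a b c : sphere_int (monom a b c \o cyc) = sphere_int (monom a b c).
Proof.
have -> : monom a b c \o cyc = monom b c a.
  by apply/funext => e; rewrite /= /monom /cyc !row3E; ring.
rewrite !sphere_int_monom.
have p0 := pi_ge0 R; have p2 : 0 <= 2 * pi :> R by rewrite mulr_ge0.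
have s2 : sin (2 * pi) = 0 :> R by rewrite mulr_natl sin2pi.
have c2 : cos (2 * pi) = 1 :> R by rewrite mulr_natl cos2pi.
have sp := sinpi R.
(* Raising [x] by two multiplies the polar factor by [(x + y + 2) / (x + y + z + 3)] and the
   azimuthal one by [(x + 1) / (x + y + 2)]; the cancellation of [x + y + 2] makes the recursion
   symmetric. *)
have ca x y z : (x + y + z + 3)%:R * moment x.+2 y z = x.+1%:R * moment x y z.
  rewrite /moment.
  have h1 := trig_int_sinS p0 sp (x + y + 1) z.
  have h2 := trig_int_cosS p2 s2 y x.
  have n0 : (y + x + 2)%:R != 0 :> R by rewrite pnatr_eq0 addn2.
  apply: (mulfI n0); rewrite (_ : (x.+2 + y + 1)%N = (x + y + 1).+2); last by rewrite !addSn.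
  rewrite (_ : (x + y + 1 + z + 2)%N = (x + y + z + 3)%N) in h1; last by ring.
  rewrite (_ : (x + y + 1).+1%:R = (y + x + 2)%:R) in h1; last by rewrite addn1 addn2 addnC.
  transitivity (((x + y + z + 3)%:R * trig_int (pi : R) (x + y + 1).+2 z) *
    ((y + x + 2)%:R * trig_int (2 * pi) y x.+2)); first by ring.
  by rewrite h1 h2; ring.
have cb x y z : (x + y + z + 3)%:R * moment x y.+2 z = y.+1%:R * moment x y z.
  rewrite /moment.
  have h1 := trig_int_sinS p0 sp (x + y + 1) z.
  have h2 := trig_int_sinS p2 s2 y x.
  have n0 : (y + x + 2)%:R != 0 :> R by rewrite pnatr_eq0 addn2.
  apply: (mulfI n0); rewrite (_ : (x + y.+2 + 1)%N = (x + y + 1).+2); last by rewrite !addnS !addSn.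
  rewrite (_ : (x + y + 1 + z + 2)%N = (x + y + z + 3)%N) in h1; last by ring.
  rewrite (_ : (x + y + 1).+1%:R = (y + x + 2)%:R) in h1; last by rewrite addn1 addn2 addnC.
  transitivity (((x + y + z + 3)%:R * trig_int (pi : R) (x + y + 1).+2 z) *
    ((y + x + 2)%:R * trig_int (2 * pi) y.+2 x)); first by ring.
  by rewrite h1 h2; ring.
have cc x y z : (x + y + z + 3)%:R * moment x y z.+2 = z.+1%:R * moment x y z.
  rewrite /moment; have h1 := trig_int_cosS p0 sp (x + y + 1) z.
  rewrite (_ : (x + y + 1 + z + 2)%N = (x + y + z + 3)%N) in h1; last by ring.
  by rewrite mulrA h1; ring.
have m1 y z : moment 1 y z = 0 by rewrite /moment trig_int_cos1// mulr0.
have m2 x z : moment x 1 z = 0 by rewrite /moment trig_int_sin1// mulr0.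
have m3 x y : moment x y 1 = 0 by rewrite /moment trig_int_cos1// mul0r.
apply: (@moment_recursion_uniq (fun x y z => moment y z x) moment) => //.
- by move=> x y z; rewrite -cc; congr (_%:R * _); ring.
- by move=> x y z; rewrite -ca; congr (_%:R * _); ring.
- by move=> x y z; rewrite -cb; congr (_%:R * _); ring.
Qed.

(** Polynomial functions, given by explicit lists of coefficients and exponents, so that statements
    about integrals reduce to monomials by induction on the list. *)
Definition polyfun f := exists s : seq (R * (nat * nat * nat)), forall e,
  f e = \sum_(t <- s) t.1 * monom t.2.1.1 t.2.1.2 t.2.2 e.

Lemma polyfunD f g : polyfun f -> polyfun g -> polyfun (fun e => f e + g e).
Proof.
by move=> [s fs] [t gt]; exists (s ++ t) => e; rewrite big_cat/= -fs -gt.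
Qed.

Lemma polyfunM f g : polyfun f -> polyfun g -> polyfun (fun e => f e * g e).
Proof.
move=> [s fs] [t gt]; exists [seq (x.1 * y.1, (x.2.1.1 + y.2.1.1, x.2.1.2 + y.2.1.2,
  x.2.2 + y.2.2)%N) | x <- s, y <- t] => e.
rewrite big_allpairs_dep/= fs gt big_distrl/=; apply: eq_bigr => x _.
rewrite big_distrr/=; apply: eq_bigr => y _.
by rewrite /monom !exprD; ring.
Qed.

Lemma polyfun_cst (k : R) : polyfun (fun=> k).
Proof.
exists [:: (k, (0, 0, 0)%N)] => e.
by rewrite big_seq1 /monom /= !expr0 !mulr1.
Qed.

Lemma polyfun_coord j : polyfun (fun e => e ord0 j).
Proof.
elim/ord3_ind: j; [exists [:: (1, (1, 0, 0)%N)]|exists [:: (1, (0, 1, 0)%N)]|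
  exists [:: (1, (0, 0, 1)%N)]] => e; by rewrite big_seq1 /monom /= !expr0 !expr1 ?mulr1 ?mul1r.
Qed.

Lemma polyfun_sum3 (F : 'I_3 -> 'rV[R]_3 -> R) : (forall j, polyfun (F j)) ->
  polyfun (fun e => \sum_(j < 3) F j e).
Proof.
move=> hF; rewrite (_ : (fun e => _) = fun e => F 0 e + F 1 e + F 2 e); last first.
  by apply/funext => e; rewrite sum3.
by do 2 apply: polyfunD => //.
Qed.

Lemma polyfun_horner (P : {poly R}) f : polyfun f -> polyfun (fun e => P.[f e]).
Proof.
move=> pf; elim/poly_ind: P => [|P c IH].
  by rewrite (_ : (fun e => _) = fun=> 0); [exact: polyfun_cst|apply/funext => e; rewrite horner0].
rewrite (_ : (fun e => _) = fun e => P.[f e] * f e + c).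
  by apply: polyfunD; [exact: polyfunM|exact: polyfun_cst].
by apply/funext => e; rewrite !hornerE.
Qed.

Lemma polyfun_continuous f : polyfun f -> continuous f.
Proof.
move=> [s fs]; have -> : f = fun e => \sum_(t <- s) t.1 * monom t.2.1.1 t.2.1.2 t.2.2 e.
  by apply/funext => e; exact: fs.
elim: s {f fs} => [|t s IH].
  rewrite (_ : (fun e => _) = fun=> 0); first exact: cst_continuous.
  by apply/funext => e; rewrite big_nil.
rewrite (_ : (fun e => _) = fun e => t.1 * monom t.2.1.1 t.2.1.2 t.2.2 e +
    \sum_(t <- s) t.1 * monom t.2.1.1 t.2.1.2 t.2.2 e); last first.
  by apply/funext => e; rewrite big_cons.
move=> e; apply: (@cvgD _ _ _ (nbhs e)); last exact: IH.
by apply: (@cvgM _ _ (nbhs e)); [exact: cvg_cst|exact: continuous_monom].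
Qed.

Lemma sphere_int_polyfun_cyc f : polyfun f -> sphere_int (f \o cyc) = sphere_int f.
Proof.
pose F (s : seq (R * (nat * nat * nat))) e := \sum_(t <- s) t.1 * monom t.2.1.1 t.2.1.2 t.2.2 e.
move=> [s fs]; have -> : f = F s by apply/funext => e; exact: fs.
have cF s' : continuous (F s') by apply: polyfun_continuous; exists s'.
have ccomp (h : 'rV[R]_3 -> R) : continuous h -> continuous (fun e => h (cyc e)).
  by move=> ch e; apply: continuous_comp; [exact: continuous_cyc|exact: ch].
have lin (k : R) (g h : 'rV[R]_3 -> R) : continuous g -> continuous h ->
    sphere_int (fun e => k * g e + h e) = k * sphere_int g + sphere_int h.
  move=> cg ch; rewrite sphere_intD ?sphere_intZ// => e.
  by apply: (@cvgM _ _ (nbhs e)); [exact: cvg_cst|exact: cg].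
elim: s {f fs} => [|t s IH].
  by apply: eq_sphere_int => e _; rewrite /F /= !big_nil.
pose m e := monom t.2.1.1 t.2.1.2 t.2.2 e.
have cm : continuous m by exact: continuous_monom.
have mcyc : sphere_int (fun e => m (cyc e)) = sphere_int m by exact: sphere_int_monom_cyc.
have FE : F (t :: s) = fun e => t.1 * m e + F s e.
  by apply/funext => e; rewrite /F big_cons.
have FcE : F (t :: s) \o cyc = fun e => t.1 * m (cyc e) + F s (cyc e).
  by apply/funext => e; rewrite /= FE.
rewrite FcE (lin _ _ _ (ccomp _ cm) (ccomp _ (cF s))) mcyc IH.
by rewrite FE (lin _ _ _ cm (cF s)).
Qed.

(* Weierstrass approximation of x^p reduces the claim to polynomials. *)
Lemma sphere_int_powR_cyc (p : R) f : 1 <= p -> polyfun f -> (forall e, 0 <= f e) ->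
  sphere_int (fun e => f (cyc e) `^ p) = sphere_int (fun e => f e `^ p).
Proof.
move=> p1 pf f0.
have cf := polyfun_continuous pf.
have [K hK] := sphere_bounded cf.
(* A positive bound, by which [f] is scaled into [[0, 1]], the interval of the approximation. *)
pose M := Num.max K 1; have M0 : 0 < M by rewrite lt_max ltr01 orbT.
have fM e : sphere2 e -> 0 <= f e / M <= 1.
  move=> he; apply/andP; split; first by rewrite divr_ge0// ltW.
  by rewrite ler_pdivrMr// mul1r le_max (le_trans (ler_norm _) (hK e he)).
have [L L0 hL] := powR_lipschitz01 p1.
pose h := fun e => f e `^ p.
have ch : continuous h.
  have -> : h = fun e => `|f e| `^ p by apply/funext => e; rewrite /h ger0_norm.
  move=> e; apply: (@continuous_comp _ _ _ f (fun x : R => `|x| `^ p)); first exact: cf.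
  exact: continuous_abs_powR.
have chc : continuous (h \o cyc).
  by move=> e; apply: continuous_comp; [exact: continuous_cyc|exact: ch].
have approx (eps : R) : 0 < eps -> exists P : {poly R}, forall e, sphere2 e ->
    `|P.[f e / M] * M `^ p - h e| <= eps.
  move=> e0; have Mp0 : 0 < M `^ p by exact: powR_gt0.
  have [P hP] := lipschitz_approx L0 hL (divr_gt0 e0 Mp0).
  exists P => e he.
  have -> : h e = (f e / M) `^ p * M `^ p.
    by rewrite -powRM ?divfK ?(lt0r_neq0 M0)// ?(ltW M0)// divr_ge0// ltW.
  rewrite -mulrBl normrM (gtr0_norm Mp0) -ler_pdivlMr//.
  exact/hP/fM.
apply/eqP; rewrite -subr_eq0 -normr_le0; apply/ler_addgt0Pl => eps e0.
rewrite addr0.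
have pi4 : 0 < 4 * pi :> R by rewrite mulr_gt0// pi_gt0.
(* The sphere has area [4 * pi], so a uniform error [d] changes an integral by at most [eps / 2]. *)
pose d := eps / 2 / (4 * pi).
have d0 : 0 < d by rewrite !divr_gt0.
have [P hP] := approx d d0.
pose g e := P.[f e * M^-1] * M `^ p.
have pg : polyfun g.
  apply: polyfunM; last exact: polyfun_cst.
  by apply: polyfun_horner; apply: polyfunM => //; exact: polyfun_cst.
have cg := polyfun_continuous pg.
have cgc : continuous (g \o cyc).
  by move=> e; apply: continuous_comp; [exact: continuous_cyc|exact: cg].
have ccst : continuous (fun _ : 'rV[R]_3 => d) by exact: cst_continuous.
have close u v : continuous u -> continuous v ->
    (forall e, sphere2 e -> `|u e - v e| <= d) -> `|sphere_int u - sphere_int v| <= eps / 2.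
  move=> cu cv uv.
  have E : d * (4 * pi) = eps / 2 by rewrite /d divfK// lt0r_neq0.
  rewrite ler_norml lerBlDr lerNl opprB lerBlDr -E -sphere_int_cst -!sphere_intD//.
  apply/andP; split; apply: le_sphere_int => //.
  - by move=> e; apply: (@cvgD _ _ _ (nbhs e)); [exact: ccst|exact: cu].
  - move=> e /uv; rewrite ler_norml => /andP[+ _].
    by rewrite lerNl opprB lerBlDr.
  - by move=> e; apply: (@cvgD _ _ _ (nbhs e)); [exact: ccst|exact: cv].
  - by move=> e /uv; rewrite ler_norml lerBlDr => /andP[_].
have h1 : `|sphere_int (g \o cyc) - sphere_int (h \o cyc)| <= eps / 2.
  by apply: close => // e he; apply: hP; exact: sphere2_cyc.
have h2 : `|sphere_int g - sphere_int h| <= eps / 2 by exact: close.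
have tri (A B G : R) : `|G - A| <= eps / 2 -> `|G - B| <= eps / 2 -> `|A - B| <= eps.
  move=> hA hB; rewrite [eps]splitr; apply: le_trans (lerD hA hB).
  by rewrite (distrC G A) ler_distD.
rewrite sphere_int_polyfun_cyc// in h1.
exact: (tri _ _ _ h1 h2).
Qed.

End CyclicInvariance.

(** * Quadratic forms on the sphere *)

Section QuadraticForm.
Context {R : realType}.
Notation mu := (@lebesgue_measure R).
Implicit Types (A : 'I_3 -> 'I_3 -> R) (f : 'rV[R]_3 -> R) (e : 'rV[R]_3) (p : R).

(** Bracketed exactly as the right-hand side of [spin_varE], which makes [spin_var] a [qform] by
    that lemma alone. *)
Definition qform A e : R := \sum_(j < 3) \sum_(k < 3) e ord0 j * (e ord0 k * A j k).

Lemma polyfun_qform A : polyfun (qform A).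
Proof.
apply: polyfun_sum3 => j; apply: polyfun_sum3 => k.
apply: polyfunM; first exact: polyfun_coord.
by apply: polyfunM; [exact: polyfun_coord|exact: polyfun_cst].
Qed.

Lemma qformE A (x y z : R) : qform A (row3 x y z) =
  x ^+ 2 * A 0 0 + y ^+ 2 * A 1 1 + z ^+ 2 * A 2 2 + x * y * (A 0 1 + A 1 0) +
  x * z * (A 0 2 + A 2 0) + y * z * (A 1 2 + A 2 1).
Proof. by rewrite /qform !sum3 !row3E; ring. Qed.

Lemma continuous_polyfun_powR p f : 1 <= p -> polyfun f -> (forall e, 0 <= f e) ->
  continuous (fun e => f e `^ p).
Proof.
move=> p1 pf f0; have -> : (fun e => f e `^ p) = fun e => `|f e| `^ p.
  by apply/funext => e; rewrite ger0_norm.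
move=> e; apply: (@continuous_comp _ _ _ f (fun x : R => `|x| `^ p)).
  exact: polyfun_continuous.
exact: continuous_abs_powR.
Qed.

Definition transverse e : R := e ord0 0 ^+ 2 + e ord0 1 ^+ 2.

Lemma polyfun_sqr j : polyfun (fun e => e ord0 j ^+ 2).
Proof. by apply: polyfunM; exact: polyfun_coord. Qed.

Lemma polyfun_transverse : polyfun transverse.
Proof. by apply: polyfunD; exact: polyfun_sqr. Qed.

Lemma transverse_ge0 e : 0 <= transverse e.
Proof. by rewrite addr_ge0 ?sqr_ge0. Qed.

(* Averaging over the rotations by multiples of pi / 2 about the third axis
   removes all mixed terms of the quadratic form. *)
Lemma qform_average p A : 1 <= p -> (forall e, 0 <= qform A e) ->
  sphere_int (fun e => ((A 0 0 + A 1 1) / 2 * transverse e + A 2 2 * e ord0 2 ^+ 2) `^ p) <=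
  sphere_int (fun e => qform A e `^ p).
Proof.
move=> p1 A0.
have cq := continuous_polyfun_powR p1 (polyfun_qform A) A0.
have half u w : u ^+ 2 + w ^+ 2 = 1 -> forall f, continuous f -> (forall e, 0 <= f e) ->
    continuous (fun e => f e `^ p) -> continuous (fun e => ((f e + f (rotz u w e)) / 2) `^ p) ->
    sphere_int (fun e => ((f e + f (rotz u w e)) / 2) `^ p) <= sphere_int (fun e => f e `^ p).
  move=> uw f cf f0 cfp chp.
  have crot : continuous (fun e => f (rotz u w e) `^ p).
    move=> e; apply: (@continuous_comp _ _ _ (rotz u w) (fun e => f e `^ p)).
      exact: continuous_rotz.
    exact: cfp.
  have E : sphere_int (fun e => 2^-1 * (f e `^ p + f (rotz u w e) `^ p)) =
      sphere_int (fun e => f e `^ p).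
    rewrite (@sphere_intZ R 2^-1 (fun e => f e `^ p + f (rotz u w e) `^ p)); last first.
      by move=> e; apply: (@cvgD _ _ _ (nbhs e)); [exact: cfp|exact: crot].
    rewrite sphere_intD//.
    have -> := sphere_int_rotz uw cfp.
    by move: (sphere_int _) => S; lra.
  rewrite -E; apply: le_sphere_int => //.
    move=> e; apply: (@cvgM _ _ (nbhs e)); first exact: cvg_cst.
    by apply: (@cvgD _ _ _ (nbhs e)); [exact: cfp|exact: crot].
  by move=> e _; rewrite [leRHS]mulrC; exact: (powR_midpoint p1 (f0 e) (f0 (rotz u w e))).
have polyrot u w f : polyfun f -> polyfun (fun e => f (rotz u w e)).
  move=> [s fs]; rewrite (_ : (fun e => f (rotz u w e)) =
      fun e => \sum_(t <- s) t.1 * monom t.2.1.1 t.2.1.2 t.2.2 (rotz u w e)); last first.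
    by apply/funext => e; exact: fs.
  have pX g n : polyfun g -> polyfun (fun e => g e ^+ n).
    move=> pg; elim: n => [|n IH]; first exact: polyfun_cst.
    rewrite (_ : (fun e => _) = fun e => g e * g e ^+ n); first exact: polyfunM.
    by apply/funext => e; rewrite exprS.
  elim: s {f fs} => [|t s IH].
    rewrite (_ : (fun e => _) = fun=> 0); first exact: polyfun_cst.
    by apply/funext => e; rewrite big_nil.
  rewrite (_ : (fun e => _) = fun e => t.1 * monom t.2.1.1 t.2.1.2 t.2.2 (rotz u w e) +
    \sum_(t <- s) t.1 * monom t.2.1.1 t.2.1.2 t.2.2 (rotz u w e)); last first.
    by apply/funext => e; rewrite big_cons.
  apply: polyfunD => //; apply: polyfunM; first exact: polyfun_cst.
  apply: polyfunM; [apply: polyfunM|]; apply: pX.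
  - rewrite (_ : (fun e => _) = fun e => u * e ord0 0 + (- w) * e ord0 1).
      by apply: polyfunD; apply: polyfunM; (exact: polyfun_cst || exact: polyfun_coord).
    by apply/funext => e; rewrite /rotz row3E mulNr.
  - rewrite (_ : (fun e => _) = fun e => w * e ord0 0 + u * e ord0 1).
      by apply: polyfunD; apply: polyfunM; (exact: polyfun_cst || exact: polyfun_coord).
    by apply/funext => e; rewrite /rotz row3E.
  - rewrite (_ : (fun e => _) = fun e => e ord0 2); first exact: polyfun_coord.
    by apply/funext => e; rewrite /rotz row3E.
(* The four-fold average is taken as two midpoints: the half turn removes the terms in [x z] and
   [y z], then the quarter turn removes [x y] and equalises the first two diagonal entries. *)
pose q1 e := (qform A e + qform A (rotz (- 1) 0 e)) / 2.
have uw1 : (- 1) ^+ 2 + 0 ^+ 2 = 1 :> R by rewrite sqrrN expr1n expr0n addr0.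
have uw2 : 0 ^+ 2 + 1 ^+ 2 = 1 :> R by rewrite expr1n expr0n add0r.
have pq1 : polyfun q1.
  apply: polyfunM; last exact: polyfun_cst.
  by apply: polyfunD; [exact: polyfun_qform|apply: polyrot; exact: polyfun_qform].
have q10 e : 0 <= q1 e by rewrite divr_ge0// addr_ge0.
have pq2 : polyfun (fun e => (q1 e + q1 (rotz 0 1 e)) / 2).
  apply: polyfunM; last exact: polyfun_cst.
  by apply: polyfunD => //; exact: polyrot.
have q20 e : 0 <= (q1 e + q1 (rotz 0 1 e)) / 2 by rewrite divr_ge0// addr_ge0.
have cq1 := continuous_polyfun_powR p1 pq1 q10.
apply: le_trans (half _ _ uw1 _ (polyfun_continuous (polyfun_qform A)) A0 cq cq1).
have := half _ _ uw2 _ (polyfun_continuous pq1) q10 cq1 (continuous_polyfun_powR p1 pq2 q20).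
apply: le_trans.
rewrite le_eqVlt; apply/orP; left; apply/eqP; apply: eq_sphere_int => e _; congr (_ `^ p).
rewrite /q1 (row3_eta e) /rotz !row3E !qformE /transverse !row3E.
by field.
Qed.

Definition transverse_int p : R := sphere_int (fun e => transverse e `^ p).

Definition axial_int p : R := sphere_int (fun e => (e ord0 2 ^+ 2) `^ p).

Lemma trig_int_sin1cos0 : trig_int pi 1 0 = 2 :> R.
Proof.
have d (x : R) : is_derive x (1 : R) (- cos : R -> R) (sin x : R).
  by apply: is_derive_eq; rewrite opprK.
rewrite /trig_int (_ : (fun x : R => _) = sin); last first.
  by apply/funext => x; rewrite expr1 expr0 mulr1.
rewrite (Rintegral_derive (pi_ge0 R) d); last exact: continuous_sin.
by rewrite !fctE cospi cos0 opprK.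
Qed.

(** On the sphere [z^2 <= 1], so an integer [k >= p] bounds the integrand below by the monomial
    [z^(2k)], whose integral is positive by the recursion. This positivity is what forces [V_33 = 0]
    in the case of equality. *)
Lemma axial_int_gt0 p : 1 <= p -> 0 < axial_int p.
Proof.
move=> p1; pose k := (Num.truncn p).+1.
have pk : p <= k%:R by rewrite ltW// truncnS_gt.
have p0 := pi_ge0 R.
have p2 : 0 <= 2 * pi :> R by rewrite mulr_ge0.
apply: (@lt_le_trans _ _ (sphere_int (monom 0 0 (2 * k)))).
  rewrite sphere_int_monom mulr_gt0//.
    elim: k {pk} => [|k IH].
      by rewrite trig_int_sin1cos0 ltr0n.
    have := trig_int_cosS p0 (sinpi R) (0 + 0 + 1) (2 * k).
    rewrite (_ : (2 * k.+1)%N = (2 * k).+2); last by rewrite mulnS.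
    move=> E; have : 0 < (0 + 0 + 1 + 2 * k + 2)%:R * trig_int (pi : R) (0 + 0 + 1) (2 * k).+2.
      by rewrite E mulr_gt0// ltr0n.
    by rewrite pmulr_rgt0// ltr0n addn2.
  rewrite /trig_int (_ : (fun x : R => _) = fun=> 1); last first.
    by apply/funext => x; rewrite !expr0 mulr1.
  have d (x : R) : is_derive x (1 : R) (@id R) (1 : R) by exact: is_derive_id.
  rewrite (Rintegral_derive p2 d); last exact: cst_continuous.
  by rewrite /= subr0 mulr_gt0// pi_gt0.
apply: le_sphere_int.
- exact: continuous_monom.
- apply: continuous_polyfun_powR => //; first exact: polyfun_sqr.
  by move=> e; exact: sqr_ge0.
move=> e /sphere2E he; rewrite /monom !expr0 !mul1r exprM -powR_mulrn ?sqr_ge0//.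
have z1 : e ord0 2 ^+ 2 <= 1 by rewrite -he lerDr addr_ge0// sqr_ge0.
have [->|zn0] := eqVneq (e ord0 2 ^+ 2) 0.
  by rewrite !powR0// ?pnatr_eq0// gt_eqF// (lt_le_trans ltr01).
by apply: ger_powR => //; rewrite z1 andbT lt_def zn0 sqr_ge0.
Qed.

Lemma transverse_int_gt0 p : 1 <= p -> 0 < transverse_int p.
Proof.
move=> p1; apply: lt_le_trans (axial_int_gt0 p1) _.
rewrite /axial_int.
have sq0 j (e : 'rV[R]_3) : 0 <= e ord0 j ^+ 2 by exact: sqr_ge0.
(* Cyclic invariance moves the axial integral to the first axis, where [transverse] dominates its
   integrand. *)
have -> : sphere_int (fun e : 'rV[R]_3 => (e ord0 2 ^+ 2) `^ p) =
    sphere_int (fun e : 'rV[R]_3 => (e ord0 0 ^+ 2) `^ p).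
  rewrite -(sphere_int_powR_cyc p1 (polyfun_sqr 0) (sq0 0)).
  by apply: eq_sphere_int => e _; rewrite /cyc row3E.
apply: le_sphere_int.
- exact: (continuous_polyfun_powR p1 (polyfun_sqr 0) (sq0 0)).
- exact: (continuous_polyfun_powR p1 polyfun_transverse transverse_ge0).
move=> e _; apply: ge0_ler_powR; rewrite ?nnegrE ?sqr_ge0 ?transverse_ge0//.
- exact: le_trans ler01 p1.
- by rewrite lerDl sqr_ge0.
Qed.

Lemma sphere_int_transverseZ p (a : R) : 1 <= p -> 0 <= a ->
  sphere_int (fun e => (a * transverse e) `^ p) = a `^ p * transverse_int p.
Proof.
move=> p1 a0; rewrite -sphere_intZ; last first.
  exact: (continuous_polyfun_powR p1 polyfun_transverse transverse_ge0).
by apply: eq_sphere_int => e _; rewrite powRM// transverse_ge0.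
Qed.

Lemma sphere_int_qform_ge p A : 1 <= p -> (forall e, 0 <= qform A e) ->
  ((A 0 0 + A 1 1) / 2) `^ p * transverse_int p + A 2 2 `^ p * axial_int p <=
  sphere_int (fun e => qform A e `^ p).
Proof.
move=> p1 A0; apply: le_trans (qform_average p1 A0).
have sq0 (e : 'rV[R]_3) : 0 <= e ord0 2 ^+ 2 by exact: sqr_ge0.
have a0 : 0 <= (A 0 0 + A 1 1) / 2.
  have := A0 (row3 1 0 0); have := A0 (row3 0 1 0); rewrite !qformE; lra.
have b0 : 0 <= A 2 2 by have := A0 (row3 0 0 1); rewrite !qformE; lra.
set a := _ / 2 in a0 *; set b := A 2 2 in b0 *.
have cu := continuous_polyfun_powR p1 polyfun_transverse transverse_ge0.
have cz := continuous_polyfun_powR p1 (polyfun_sqr 2) sq0.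
have cZ (k : R) f : continuous f -> continuous (fun e => k * f e).
  by move=> cf e; apply: (@cvgM _ _ (nbhs e)); [exact: cvg_cst|exact: cf].
rewrite /transverse_int /axial_int -(sphere_intZ _ cu) -(sphere_intZ _ cz).
rewrite -sphere_intD; [|exact: cZ|exact: cZ].
apply: le_sphere_int.
- by move=> e; apply: (@cvgD _ _ _ (nbhs e)); [exact: (cZ _ _ cu)|exact: (cZ _ _ cz)].
- apply: (@continuous_polyfun_powR p (fun e => a * transverse e + b * e ord0 2 ^+ 2)) => //.
    apply: polyfunD; apply: polyfunM; [exact: polyfun_cst|exact: polyfun_transverse|
      exact: polyfun_cst|exact: polyfun_sqr].
  by move=> e; rewrite addr_ge0// mulr_ge0// transverse_ge0.
move=> e _; rewrite -!powRM ?transverse_ge0//.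
by apply: powR_superadditive => //; apply: mulr_ge0 => //; exact: transverse_ge0.
Qed.

Lemma transverse_intE p : 1 <= p ->
  transverse_int p = 2 * pi * (\int[mu]_(t in `[0%R, pi]) ((sin t ^+ 2) `^ p * sin t))%R.
Proof.
move=> p1; rewrite /transverse_int sphere_intE.
set W := (\int[mu]_(t in `[0%R, pi]) _)%R.
rewrite (_ : theta_int _ = fun=> W); last first.
  apply/funext => phi; apply: eq_Rintegral => t _; congr (_ `^ p * _).
  by rewrite /transverse sphE !row3E !exprMn -mulrDr cos2Dsin2 mulr1.
have d (x : R) : is_derive x (1 : R) (W \*: (@id R)) (W : R).
  by apply: is_derive_eq; rewrite /GRing.scale/= mulr1.
rewrite (Rintegral_derive _ d); last exact: cst_continuous.
- have E x : (W \*: (@id R)) x = W * x by [].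
  by rewrite !E mulr0 subr0 mulrC.
- by rewrite mulr_ge0// pi_ge0.
Qed.

Lemma sine_integral_nat (k : nat) :
  (\int[mu]_(t in `[0%R, pi]) ((sin t ^+ 2) `^ k%:R * sin t))%R =
  trig_int pi (2 * k + 1) 0.
Proof.
apply: eq_Rintegral => t _.
by rewrite powR_mulrn ?sqr_ge0// -exprM expr0 mulr1 exprD expr1.
Qed.

Lemma trig_int_sin_1_3_5 :
  [/\ trig_int pi 1 0 = 2 :> R, trig_int pi 3 0 = 4 / 3 :> R & trig_int pi 5 0 = 16 / 15 :> R].
Proof.
have p0 := pi_ge0 R.
have e1 := trig_int_sin1cos0.
have e3 : trig_int pi 3 0 = 4 / 3 :> R.
  have := trig_int_sinS p0 (sinpi R) 1 0; rewrite e1 /= => h; lra.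
split => //.
have := trig_int_sinS p0 (sinpi R) 3 0; rewrite e3 /= => h; lra.
Qed.

End QuadraticForm.

(** * The Gamma function *)

Section GammaFunction.
Context {R : realType}.
Notation mu := (@lebesgue_measure R).
Implicit Types (a p x r t : R).

(** Extended-real, so that Tonelli's theorem applies before finiteness is known; the exponent is the
    argument of [Gamma] minus one. *)
Definition gamma_int a : \bar R :=
  (\int[mu]_(t in `]0%R, +oo[) (t `^ a * expR (- t))%:E)%E.

Lemma GammaE x : Gamma x = fine (gamma_int (x - 1)).
Proof. by []. Qed.

Lemma measurable_gamma a (D : set R) :
  measurable_fun D (fun t => t `^ a * expR (- t)).
Proof.
apply: measurable_funTS; apply: measurable_funM; first exact: measurable_powR.
apply: continuous_measurable_fun => t.
by apply: (@continuous_comp _ _ _ (fun t => - t) expR);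
  [exact: opp_continuous|exact: continuous_expR].
Qed.

Lemma gamma_int_gt0 a : 0 <= a -> (0 < gamma_int a)%E.
Proof.
move=> a0; apply: (@lt_le_trans _ _ (expR (- 2))%:E); first by rewrite lte_fin expR_gt0.
apply: (@le_trans _ _ (\int[mu]_(t in `[1%R, 2%R]) (t `^ a * expR (- t))%:E)%E); last first.
  apply: ge0_subset_integral => //.
  - by apply/measurable_EFinP; exact: measurable_gamma.
  - by move=> t _; rewrite lee_fin mulr_ge0 ?powR_ge0 ?expR_ge0.
  - by move=> t /=; rewrite !in_itv/= andbT => /andP[t1 _]; exact: lt_le_trans ltr01 t1.
apply: (@le_trans _ _ (\int[mu]_(t in `[1%R, 2%R]) (expR (- 2))%:E)%E).
  rewrite integral_cst//= lebesgue_measure_itv/= lte_fin ltr1n/=.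
  by rewrite -EFinD -EFinM lee_fin (_ : 2 - 1 = 1) ?mulr1//; ring.
apply: ge0_le_integral => //.
  by apply/measurable_EFinP; exact: measurable_gamma.
move=> t /=; rewrite in_itv/= => /andP[t1 t2]; rewrite lee_fin -[leLHS]mul1r.
rewrite ler_pM ?expR_ge0// ?ler_expR ?lerN2//.
by have := ler_powR t1 a0; rewrite powRr0.
Qed.

(** With [y = t / (2a)] one has [y^a <= exp(a y) = exp(t/2)], so the integrand is at most
    [(2a)^a exp(-t/2)]. The extra [2] in [K] cancels the normalisation of the exponential density of
    rate [1/2], whose integral is [1]. *)
Lemma gamma_int_lty a : 0 < a -> (gamma_int a < +oo)%E.
Proof.
move=> a0; have half0 : 0 < 2^-1 :> R by rewrite invr_gt0.
pose K := 2 * (2 * a) `^ a.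
have K0 : 0 <= K by rewrite mulr_ge0// powR_ge0.
apply: (@le_lt_trans _ _ (\int[mu]_(t in `]0%R, +oo[) (K%:E * (exponential_pdf (2^-1 : R) t)%:E))%E).
  apply: ge0_le_integral => //.
  - by move=> t _; rewrite lee_fin mulr_ge0 ?powR_ge0 ?expR_ge0.
  - by apply/measurable_EFinP; exact: measurable_gamma.
  - by apply: measurable_funeM; apply/measurable_EFinP/measurable_funTS; exact: measurable_exponential_pdf.
  move=> t /=; rewrite in_itv/= andbT => t0; rewrite -EFinM lee_fin.
  rewrite exponential_pdfE /=; last exact: ltW.
  have a2 : 0 < 2 * a by rewrite mulr_gt0.
  have -> : t `^ a = (2 * a) `^ a * (t / (2 * a)) `^ a.
    by rewrite -powRM ?divr_ge0 ?ltW// mulrC divfK// lt0r_neq0.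
  have tb : (t / (2 * a)) `^ a <= expR (t / 2).
    have ta : 0 < t / (2 * a) by rewrite divr_gt0.
    rewrite /powR gt_eqF// ler_expR.
    have -> : t / 2 = a * (t / (2 * a)) by field; rewrite lt0r_neq0.
    rewrite ler_pM2l//; apply: le_trans (_ : ln (1 + t / (2 * a)) <= _).
      by rewrite ler_ln ?posrE ?lerDr// addr_gt0.
    by apply: le_ln1Dx; rewrite (lt_trans _ ta)// ltrN10.
  have -> : K * (2^-1 * expR (- 2^-1 * t)) = (2 * a) `^ a * (expR (t / 2) * expR (- t)).
    rewrite /K -expRD (_ : t / 2 - t = - 2^-1 * t); first by field.
    by field.
  rewrite [leRHS]mulrA; apply: ler_wpM2r; first exact: expR_ge0.
  by apply: ler_wpM2l; first exact: powR_ge0.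
rewrite ge0_integralZl_EFin//; last 2 first.
- by move=> t _; rewrite lee_fin exponential_pdf_ge0.
- by apply/measurable_EFinP/measurable_funTS; exact: measurable_exponential_pdf.
apply: (@le_lt_trans _ _ (K%:E * 1)%E); last by rewrite mule1 ltry.
rewrite lee_wpmul2l ?lee_fin// -(integral_exponential_pdf half0).
apply: ge0_subset_integral => //.
- by apply/measurable_EFinP; exact: measurable_exponential_pdf.
- by move=> t _; rewrite lee_fin exponential_pdf_ge0.
Qed.

(** * The sine integral as a quotient of Gamma values *)

Section Wallis.
Context {p : R}.
Hypothesis p1 : 1 <= p.

Let p0 : 0 < p := lt_le_trans ltr01 p1.

(* The p-th power of the positive part of y. *)
Let pospow (y : R) : R := `|(y + `|y|) / 2| `^ p.

Let pospowE y : 0 <= y -> pospow y = y `^ p.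
Proof. by move=> y0; rewrite /pospow (ger0_norm y0) (_ : _ / 2 = y) ?ger0_norm//; lra. Qed.

Let pospow0 y : y <= 0 -> pospow y = 0.
Proof.
by move=> y0; rewrite /pospow (ler0_norm y0) subrr mul0r normr0 powR0// gt_eqF.
Qed.

Let continuous_pospow : continuous pospow.
Proof.
move=> y; apply: (@continuous_comp _ _ _ (fun y : R => (y + `|y|) / 2) (fun x : R => `|x| `^ p)).
  by apply: cvgM; [apply: cvgD; [exact: cvg_id|exact: norm_continuous]|exact: cvg_cst].
exact: continuous_abs_powR.
Qed.

(** Its integral over [x] is the sine integral times an integrand of [gamma_int (p + 2^-1)]; its
    integral over [r] is a Gaussian in [x] times [gamma_int p]. The positive part in [pospow] makes
    it continuous in each variable, without cutting the domain. *)
Let kern (r x : R) : R := expR (- r) * pospow (r - x ^+ 2).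

Let kern_ge0 r x : 0 <= kern r x.
Proof. by rewrite mulr_ge0 ?expR_ge0 ?powR_ge0. Qed.

Let continuous_expRN : continuous (fun r : R => expR (- r)).
Proof.
by move=> t; apply: (@continuous_comp _ _ _ (fun t => - t) expR);
  [exact: opp_continuous|exact: continuous_expR].
Qed.

Let continuous_kern_x r : continuous (kern r).
Proof.
move=> x; apply: cvgM; first exact: cvg_cst.
apply: (@continuous_comp _ _ _ (fun x : R => r - x ^+ 2) pospow); last exact: continuous_pospow.
by apply: cvgB; [exact: cvg_cst|exact: exprn_continuous].
Qed.

Let continuous_kern_r x : continuous (kern ^~ x).
Proof.
move=> r; apply: cvgM; first exact: continuous_expRN.
apply: (@continuous_comp _ _ _ (fun r : R => r - x ^+ 2) pospow); last exact: continuous_pospow.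
by apply: cvgB; [exact: cvg_id|exact: cvg_cst].
Qed.

Let measurable_kern : measurable_fun setT (fun z : R * R => (kern z.1 z.2)%:E).
Proof.
apply/measurable_EFinP; apply: measurable_funM.
  apply: (measurableT_comp (continuous_measurable_fun continuous_expRN)).
  exact: measurable_fst.
apply: (measurableT_comp (continuous_measurable_fun continuous_pospow)).
apply: measurable_funB; first exact: measurable_fst.
by apply: measurable_funX; exact: measurable_snd.
Qed.

Definition sine_power_int : R := (\int[mu]_(t in `[0%R, pi]) ((sin t ^+ 2) `^ p * sin t))%R.
Local Notation W := sine_power_int.

Let continuous_sine_power : continuous (fun t : R => (sin t ^+ 2) `^ p * sin t).
Proof.
have c : continuous (fun t : R => (sin t ^+ 2) `^ p).
  rewrite (_ : (fun t : R => _) = fun t => `|sin t ^+ 2| `^ p); last first.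
    by apply/funext => x; rewrite ger0_norm ?sqr_ge0.
  move=> t; apply: (@continuous_comp _ _ _ (fun t : R => sin t ^+ 2) (fun x : R => `|x| `^ p)).
    apply: (@continuous_comp _ _ _ sin (fun y : R => y ^+ 2)); first exact: continuous_sin.
    exact: exprn_continuous.
  exact: continuous_abs_powR.
by move=> t; apply: cvgM; [exact: c|exact: continuous_sin].
Qed.

(* Substitution x = - sqrt r * cos t. *)
Let integral_kern_x r : 0 < r ->
  (\int[mu]_x (kern r x)%:E = W%:E * (r `^ (p + 2^-1) * expR (- r))%:E)%E.
Proof.
move=> r0; pose q := Num.sqrt r; have q0 : 0 < q by rewrite sqrtr_gt0.
have qq : q ^+ 2 = r by rewrite sqr_sqrtr// ltW.
pose F t := - q * cos t.
have F0 : F 0 = - q by rewrite /F cos0 mulr1.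
have Fpi : F pi = q by rewrite /F cospi mulrN1 opprK.
have dF t : is_derive t (1 : R) F (q * sin t).
  rewrite (_ : F = (- q) \*: (cos : R -> R)); last by apply/funext.
  by apply: is_derive_eq; rewrite /GRing.scale/= mulrNN.
have F'E : F^`()%classic = fun t => q * sin t.
  by apply/funext => t; rewrite derive1E; exact: derive_val.
have cF' : continuous (fun t : R => q * sin t).
  by move=> t; apply: cvgM; [exact: cvg_cst|exact: continuous_sin].
have cF : continuous F.
  by move=> t; apply: cvgM; [exact: cvg_cst|exact: continuous_cos].
transitivity (\int[mu]_(x in `[F 0%R, F pi]) (kern r x)%:E)%E.
  rewrite [RHS]integral_mkcond; apply: eq_integral => x _.
  rewrite patchE; case: ifPn => // /negP hx; rewrite /kern pospow0 ?mulr0//.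
  rewrite leNgt; apply/negP => x2; apply: hx; rewrite inE/= in_itv/= F0 Fpi -ler_norml.
  rewrite -(@ler_pXn2r _ 2)//; last by rewrite nnegrE ltW.
  by rewrite real_normK ?num_real// qq -subr_ge0 ltW.
rewrite (@integration_by_substitution_increasing _ F (kern r) 0 pi) ?pi_ge0//; last 6 first.
- move=> x y hx hy xy; rewrite /F !mulNr ltrN2 ltr_pM2l//.
  by rewrite ltr_cos.
- by rewrite F'E => t _; exact: cF'.
- by rewrite F'E; apply: cvgP; apply: cvg_at_right_filter; exact: cF'.
- by rewrite F'E; apply: cvgP; apply: cvg_at_left_filter; exact: cF'.
- split.
  + by move=> t _; have [] := dF t.
  + by apply: cvg_at_right_filter; exact: cF.
  + by apply: cvg_at_left_filter; exact: cF.
- exact/continuous_subspaceT/continuous_kern_x.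
transitivity (\int[mu]_(t in `[0%R, pi]) ((r `^ (p + 2^-1) * expR (- r))%:E *
    ((sin t ^+ 2) `^ p * sin t)%:E))%E.
  apply: eq_integral => t _; rewrite fctE /= F'E -EFinM; congr EFin.
  rewrite /kern /F (_ : r - _ = r * sin t ^+ 2); last first.
    by rewrite exprMn sqrrN qq sin2cos2; ring.
  have rs : 0 <= r * sin t ^+ 2 by rewrite mulr_ge0 ?sqr_ge0// ltW.
  rewrite (pospowE rs) (powRM _ (ltW r0) (sqr_ge0 _)) powRD; last first.
    by rewrite (gt_eqF r0) implybT.
  by rewrite (powR12_sqrt (ltW r0)) -/q; ring.
rewrite ge0_integralZl_EFin//.
- rewrite muleC; congr (_ * _)%E; rewrite /W /Rintegral fineK//.
  by apply: integrable_fin_num => //; exact: continuous_itv_integrable.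
- by move=> t /=; rewrite in_itv/= => h; rewrite lee_fin mulr_ge0 ?powR_ge0// sin_ge0_pi.
- by apply/measurable_EFinP/measurable_funTS; exact: continuous_measurable_fun.
- by rewrite mulr_ge0 ?powR_ge0 ?expR_ge0.
Qed.

Let integral_kern_x0 r : r <= 0 -> (\int[mu]_x (kern r x)%:E = 0)%E.
Proof.
move=> r0; apply: integral0_eq => x _.
by rewrite /kern pospow0 ?mulr0// subr_le0 (le_trans r0)// sqr_ge0.
Qed.

(** The shift [r = t + x^2] factors [exp(-r)] into [exp(-t)] and the Gaussian. *)
Let integral_kern_r x : (\int[mu]_r (kern r x)%:E = (gauss_fun x)%:E * gamma_int p)%E.
Proof.
pose F t := t + x ^+ 2.
have dF t : is_derive t (1 : R) F (1 : R) by apply: is_derive_eq; rewrite addr0.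
have F'E : F^`()%classic = fun=> 1.
  by apply/funext => t; rewrite derive1E; exact: derive_val.
have cF : continuous F.
  by move=> t; apply: cvgD; [exact: cvg_id|exact: cvg_cst].
transitivity (\int[mu]_(r in `[F 0%R, +oo[) (kern r x)%:E)%E.
  rewrite [RHS]integral_mkcond; apply: eq_integral => r _.
  rewrite patchE; case: ifPn => // /negP hr; rewrite /kern pospow0 ?mulr0//.
  rewrite leNgt; apply/negP => x2; apply: hr; rewrite inE/= in_itv/= andbT /F add0r.
  by rewrite -subr_ge0 ltW.
rewrite (@increasing_ge0_integration_by_substitutiony _ F (kern ^~ x) 0); last 8 first.
- by move=> u v _ _ uv; rewrite ltrD2r.
- by rewrite F'E => t _; exact: cvg_cst.
- by rewrite F'E; exact: is_cvg_cst.
- by rewrite F'E; exact: is_cvg_cst.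
- split; first by move=> t _; have [] := dF t.
  by apply: cvg_at_right_filter; exact: cF.
- apply: cvg_addrr.
- exact/continuous_subspaceT/continuous_kern_r.
- by move=> r _; exact: kern_ge0.
rewrite -integral_itv_obnd_cbnd; last first.
  apply/measurable_EFinP/measurable_funTS.
  rewrite F'E; apply: measurable_funM => //; apply: continuous_measurable_fun.
  by move=> t; apply: continuous_comp; [exact: cF|exact: continuous_kern_r].
rewrite /gamma_int -ge0_integralZl_EFin//.
- apply: eq_integral => t; rewrite inE/= in_itv/= andbT => t0.
  rewrite fctE /= F'E mulr1 -EFinM /F /kern addrK pospowE ?ltW// opprD expRD /gauss_fun.
  by congr EFin; ring.
- by move=> t _; rewrite lee_fin mulr_ge0 ?powR_ge0 ?expR_ge0.
- by apply/measurable_EFinP; exact: measurable_gamma.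
- exact: gauss_fun_ge0.
Qed.

(** Tonelli's theorem for [kern], with the Gaussian integral [sqrt pi] on one side. *)
Lemma wallis_gamma_int :
  (W%:E * gamma_int (p + 2^-1) = (Num.sqrt pi)%:E * gamma_int p)%E.
Proof.
have W0 : 0 <= W.
  by apply: Rintegral_ge0 => t /=; rewrite in_itv/= => h;
    rewrite mulr_ge0 ?powR_ge0// sin_ge0_pi.
have G0 a : (0 <= gamma_int a)%E.
  by apply: integral_ge0 => t _; rewrite lee_fin mulr_ge0 ?powR_ge0 ?expR_ge0.
have := @fubini_tonelli _ _ _ _ R mu mu _ measurable_kern
  (fun z => (kern_ge0 z.1 z.2 : (0 <= (kern z.1 z.2)%:E)%E)).
rewrite /=.
under [X in _ = X -> _]eq_integral do rewrite integral_kern_r.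
rewrite ge0_integralZr//; last 2 first.
- by apply/measurable_EFinP; exact: measurable_gauss_fun.
- by move=> x _; rewrite lee_fin gauss_fun_ge0.
rewrite integralT_gauss => <-.
rewrite /gamma_int -ge0_integralZl_EFin//; last 2 first.
- by move=> t _; rewrite lee_fin mulr_ge0 ?powR_ge0 ?expR_ge0.
- by apply/measurable_EFinP; exact: measurable_gamma.
rewrite integral_mkcond; apply: eq_integral => r _.
rewrite patchE; case: ifPn; rewrite ?inE ?notin_setE/= in_itv/= andbT.
  by move=> r0; rewrite integral_kern_x.
by move=> /negP; rewrite -leNgt => r0; rewrite integral_kern_x0.
Qed.

Lemma wallis_Gamma :
  Num.sqrt pi * Gamma (p + 1) / (2 * Gamma (p + 3 / 2)) = W / 2.
Proof.
have e1 : p + 1 - 1 = p by ring.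
have e2 : p + 3 / 2 - 1 = p + 2^-1 by field.
rewrite !GammaE e1 e2.
have q0 : 0 < p + 2^-1 by rewrite addr_gt0// invr_gt0.
have := wallis_gamma_int.
move: (gamma_int_gt0 (ltW p0)) (gamma_int_lty p0) (gamma_int_gt0 (ltW q0)) (gamma_int_lty q0).
(* The strict bounds on both sides discard the infinite values, and [v > 0] permits the division. *)
case: (gamma_int p) => // u u0 _; case: (gamma_int _) => // v v0 _.
rewrite -!EFinM => -[E] /=; rewrite !lte_fin in u0 v0.
rewrite -E; field.
exact: lt0r_neq0.
Qed.

End Wallis.
End GammaFunction.

(** * Variances of the spin components *)

Local Open Scope complex_scope.
Local Open Scope sesquilinear_scope.

Section SphereNorm.
Context {R : realType}.
Implicit Types (f : 'rV[R]_3 -> R) (e : 'rV[R]_3) (u w : R).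

Lemma rotzK u w : u ^+ 2 + w ^+ 2 = 1 -> cancel (rotz u (- w)) (rotz u w).
Proof.
move=> uw e; rewrite [RHS]row3_eta /rotz !row3E; congr row3.
- by transitivity ((u ^+ 2 + w ^+ 2) * e ord0 0); [ring|rewrite uw mul1r].
- by transitivity ((u ^+ 2 + w ^+ 2) * e ord0 1); [ring|rewrite uw mul1r].
Qed.

Lemma sphere_norm_rotz (p : \bar R) f u w : (1%:E <= p)%E -> u ^+ 2 + w ^+ 2 = 1 ->
  polyfun f -> (forall e, 0 <= f e) -> sphere_norm p (f \o rotz u w) = sphere_norm p f.
Proof.
case: p => [p||//]; rewrite ?lee_fin => p1 uw pf f0.
  by rewrite /sphere_norm -(sphere_int_rotz uw (continuous_polyfun_powR p1 pf f0)).
rewrite /sphere_norm; congr sup; apply/seteqP; split => _ [e he <-].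
  by exists (rotz u w e) => //; exact: sphere2_rotz.
exists (rotz u (- w) e); first by apply: sphere2_rotz => //; rewrite sqrrN.
by rewrite /= rotzK.
Qed.

Lemma sphere_norm_cyc (p : \bar R) f : (1%:E <= p)%E ->
  polyfun f -> (forall e, 0 <= f e) -> sphere_norm p (f \o cyc) = sphere_norm p f.
Proof.
case: p => [p||//]; rewrite ?lee_fin => p1 pf f0.
  by rewrite /sphere_norm -(sphere_int_powR_cyc p1 pf f0).
rewrite /sphere_norm; congr sup; apply/seteqP; split => _ [e he <-].
  by exists (cyc e) => //; exact: sphere2_cyc.
(* [cyc] has order three. *)
exists (cyc (cyc e)); first by do 2 apply: sphere2_cyc.
by rewrite /= [in RHS](row3_eta e) /cyc !row3E.
Qed.

Lemma polar2 (a b : R) : exists r u w,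
  [/\ 0 <= r, u ^+ 2 + w ^+ 2 = 1, a = r * u & b = r * w].
Proof.
pose r := Num.sqrt (a ^+ 2 + b ^+ 2).
have ab0 : 0 <= a ^+ 2 + b ^+ 2 by rewrite addr_ge0 ?sqr_ge0.
have rr : r ^+ 2 = a ^+ 2 + b ^+ 2 by rewrite sqr_sqrtr.
have [r0|rn0] := eqVneq r 0.
  have : (a ^+ 2 == 0) && (b ^+ 2 == 0) by rewrite -paddr_eq0 ?sqr_ge0// -rr r0 expr0n.
  rewrite !sqrf_eq0 => /andP[/eqP -> /eqP ->].
  by exists 0, 1, 0; rewrite expr1n expr0n addr0 !mul0r.
exists r, (a / r), (b / r); split.
- exact: sqrtr_ge0.
- by rewrite !expr_div_n -mulrDl -rr divff// expf_neq0.
- by rewrite mulrC divfK.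
- by rewrite mulrC divfK.
Qed.

(** Polar coordinates in space with pairs in place of angles: [k] is the length and [(r u, r w, z)]
    the direction, the form in which [align] takes it. *)
Lemma polar3 (a b c : R) : exists k u w z r,
  [/\ 0 <= k, u ^+ 2 + w ^+ 2 = 1, z ^+ 2 + r ^+ 2 = 1 &
      [/\ a = k * (r * u), b = k * (r * w) & c = k * z]].
Proof.
have [q [u [w [_ uw -> ->]]]] := polar2 a b.
have [k [z [r [k0 zr -> ->]]]] := polar2 c q.
by exists k, u, w, z, r; rewrite !mulrA.
Qed.

End SphereNorm.

Section RotatedTriple.
Context {R : realType} {n : nat}.
Local Notation am := (@angular_momentum R[i] n.+1 (n%:R / 2)).
Implicit Types (L : 'I_3 -> 'M[R[i]]_n.+1) (rho : 'M[R[i]]_n.+1) (e : 'rV[R]_3).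

Lemma spinC : (spin R n)%:C = n%:R / 2 :> R[i].
Proof. by rewrite /spin rmorphM fmorphV !rmorph_nat. Qed.

Lemma real_complex_real (x : R) : x%:C \is Num.real.
Proof. by rewrite complex_real. Qed.

Lemma dot_mxE e L :
  dot_mx e L = (e ord0 0)%:C *: L 0 + (e ord0 1)%:C *: L 1 + (e ord0 2)%:C *: L 2.
Proof. by rewrite /dot_mx sum3. Qed.

Lemma dot_herm e L : am L -> (dot_mx e L)^t* = dot_mx e L.
Proof.
move=> h; rewrite dot_mxE.
exact: (lin3_herm (am_herm h) (real_complex_real _) (real_complex_real _) (real_complex_real _)).
Qed.

Lemma dot_rotz u w e L : dot_mx e (rotz_triple u%:C w%:C L) = dot_mx (rotz u w e) L.
Proof.
rewrite !dot_mxE /rotz !row3E /rotz_triple/= !(rmorphB, rmorphD, rmorphM) /=.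
exact: lin3_rotz.
Qed.

Lemma dot_cyc e L : dot_mx e (fun j => L (j + 1)) = dot_mx (cyc e) L.
Proof. by rewrite !dot_mxE /cyc !row3E !ord3E [LHS]addrC [LHS]addrA. Qed.

(** For Hermitian [rho] and [L] the real part amounts to symmetrising the product [L j *m L k]. *)
Definition spin_cov L rho (j k : 'I_3) : R :=
  complex.Re (\tr (rho *m (L j *m L k)) - \tr (rho *m L j) * \tr (rho *m L k)).

Lemma spin_var_qform L rho : spin_var L rho = qform (spin_cov L rho).
Proof. by apply/funext => e; exact: spin_varE. Qed.

Lemma le_Re (a : R) (z : R[i]) : a%:C <= z -> a <= complex.Re z.
Proof. by rewrite lecE => /andP[_]. Qed.

Lemma spin_var_ge0 L rho e : am L -> density_op rho -> 0 <= spin_var L rho e.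
Proof.
by move=> h hrho; have := trace_variance_ge0 hrho (dot_herm e h); rewrite lecE => /andP[_].
Qed.

Lemma polyfun_spin_var L rho : polyfun (spin_var L rho).
Proof. by rewrite spin_var_qform; exact: polyfun_qform. Qed.

(** A change of axes composed only of rotations about the current third axis and of cyclic shifts,
    the two kinds under which the sphere integral is known to be invariant. Its third axis is
    [(r u, r w, z)], see [align2]. *)
Definition align u w z r L : 'I_3 -> 'M[R[i]]_n.+1 := fun j =>
  rotz_triple z%:C r%:C (fun j => rotz_triple u%:C w%:C L (j + 1 + 1)) (j + 1).

Lemma am_rotzC u w L : u ^+ 2 + w ^+ 2 = 1 -> am L -> am (rotz_triple u%:C w%:C L).
Proof.
move=> uw h; apply: am_rotz => //; [exact: real_complex_real..|].
by rewrite -!rmorphXn -rmorphD uw.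
Qed.

Lemma am_align u w z r L : u ^+ 2 + w ^+ 2 = 1 -> z ^+ 2 + r ^+ 2 = 1 ->
  am L -> am (align u w z r L).
Proof.
move=> uw zr h.
have h1 := am_cyc (am_cyc (am_rotzC uw h)).
exact: (am_cyc (am_rotzC zr h1)).
Qed.

Lemma sphere_norm_align p u w z r L rho : (1%:E <= p)%E ->
  u ^+ 2 + w ^+ 2 = 1 -> z ^+ 2 + r ^+ 2 = 1 -> am L -> density_op rho ->
  sphere_norm p (spin_var (align u w z r L) rho) = sphere_norm p (spin_var L rho).
Proof.
move=> p1 uw zr h hrho.
have step_cyc K : am K ->
    sphere_norm p (spin_var (fun j => K (j + 1)) rho) = sphere_norm p (spin_var K rho).
  move=> hK; rewrite -(sphere_norm_cyc p1 (polyfun_spin_var K rho)).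
    by congr sphere_norm; apply/funext => e; rewrite /spin_var /= dot_cyc.
  by move=> e; exact: spin_var_ge0.
have step_rotz a b K : a ^+ 2 + b ^+ 2 = 1 -> am K ->
    sphere_norm p (spin_var (rotz_triple a%:C b%:C K) rho) = sphere_norm p (spin_var K rho).
  move=> ab hK; rewrite -(sphere_norm_rotz p1 ab (polyfun_spin_var K rho)).
    by congr sphere_norm; apply/funext => e; rewrite /spin_var /= dot_rotz.
  by move=> e; exact: spin_var_ge0.
have h0 := am_rotzC uw h; have h1 := am_cyc h0; have h2 := am_cyc h1.
have h3 := am_rotzC zr h2.
rewrite /align (step_cyc _ h3) (step_rotz _ _ _ zr h2).
by rewrite (step_cyc _ h1) (step_cyc _ h0) step_rotz.
Qed.

Lemma align2 u w z r L : align u w z r L 2 =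
  z%:C *: L 2 + r%:C *: (u%:C *: L 0 + w%:C *: L 1).
Proof. by rewrite /align !ord3E /rotz_triple/= ?ord3E. Qed.

Lemma align0 u w z r L : align u w z r L 0 =
  - r%:C *: L 2 + z%:C *: (u%:C *: L 0 + w%:C *: L 1).
Proof. by rewrite /align !ord3E /rotz_triple/= ?ord3E. Qed.

Lemma align1 u w z r L : align u w z r L 1 = - w%:C *: L 0 + u%:C *: L 1.
Proof. by rewrite /align !ord3E /rotz_triple/= ?ord3E. Qed.

(* The third axis is turned into the direction of the mean angular momentum. *)
Lemma align_mean L rho : am L -> density_op rho -> exists k u w z r,
  let K := align u w z r L in
  [/\ u ^+ 2 + w ^+ 2 = 1, z ^+ 2 + r ^+ 2 = 1, \tr (rho *m K 0) = 0,
      \tr (rho *m K 1) = 0 & 0 <= k /\ \tr (rho *m K 2) = k%:C].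
Proof.
move=> h hrho.
have mreal j : \tr (rho *m L j) = (complex.Re (\tr (rho *m L j)))%:C.
  have /complex_realP[x xE] : \tr (rho *m L j) \is Num.real.
    exact: (trace_herm_real hrho (am_herm h j)).
  by rewrite [in LHS]xE xE.
have [k [u [w [z [r [k0 uw zr [e0 e1 e2]]]]]]] := polar3 (complex.Re (\tr (rho *m L 0)))
  (complex.Re (\tr (rho *m L 1))) (complex.Re (\tr (rho *m L 2))).
have t0 : \tr (rho *m L 0) = (k * (r * u))%:C by rewrite mreal e0.
have t1 : \tr (rho *m L 1) = (k * (r * w))%:C by rewrite mreal e1.
have t2 : \tr (rho *m L 2) = (k * z)%:C by rewrite mreal e2.
exists k, u, w, z, r => K; split => //.
- rewrite /K align0 trace_lin2 trace_lin2 t0 t1 t2.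
  transitivity ((- r * (k * z) + z * (u * (k * (r * u)) + w * (k * (r * w))))%:C).
    by rewrite !(rmorphD, rmorphM, rmorphN).
  rewrite (_ : - r * _ + _ = k * r * z * (u ^+ 2 + w ^+ 2 - 1)); last by ring.
  by rewrite uw subrr mulr0.
- rewrite /K align1 trace_lin2 t0 t1.
  transitivity ((- w * (k * (r * u)) + u * (k * (r * w)))%:C).
    by rewrite !(rmorphD, rmorphM, rmorphN).
  by rewrite (_ : - w * _ + _ = 0)//; ring.
- split => //; rewrite /K align2 trace_lin2 trace_lin2 t0 t1 t2.
  transitivity ((z * (k * z) + r * (u * (k * (r * u)) + w * (k * (r * w))))%:C).
    by rewrite !(rmorphD, rmorphM).
  rewrite (_ : z * _ + _ = k * (z ^+ 2 + r ^+ 2 * (u ^+ 2 + w ^+ 2))); last by ring.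
  by rewrite uw mulr1 zr mulr1.
Qed.

Lemma align_dir L e : sphere2 e -> exists u w z r,
  [/\ u ^+ 2 + w ^+ 2 = 1, z ^+ 2 + r ^+ 2 = 1 & align u w z r L 2 = dot_mx e L].
Proof.
move=> /sphere2E he.
have [k [u [w [z [r [k0 uw zr [e0 e1 e2]]]]]]] := polar3 (e ord0 0) (e ord0 1) (e ord0 2).
have k1 : k = 1.
  apply/eqP; rewrite -(@pexpr_eq1 _ k 2)//; apply/eqP; rewrite -he e0 e1 e2.
  transitivity (k ^+ 2 * (z ^+ 2 + r ^+ 2 * (u ^+ 2 + w ^+ 2))); last by ring.
  by rewrite uw mulr1 zr mulr1.
exists u, w, z, r; split => //.
rewrite align2 dot_mxE e0 e1 e2 k1 !mul1r !rmorphM /=.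
exact: lin3_nested.
Qed.

End RotatedTriple.

Lemma qform_axes (R : realType) (A : 'I_3 -> 'I_3 -> R) :
  [/\ qform A (row3 1 0 0) = A 0 0, qform A (row3 0 1 0) = A 1 1 &
      qform A (row3 0 0 1) = A 2 2].
Proof. by split; rewrite qformE; ring. Qed.

(** The numerical core of both the bound and its rigidity, for [c = s / 2], [x = (V_11 + V_22) / 2],
    [b = V_33]: since [U] and [Z] are positive, equality leaves no room in either term. *)
Lemma powR_sum_bound (R : realType) (p x b c I U Z : R) : 1 <= p -> 0 < U -> 0 < Z ->
  0 <= c -> c <= x -> 0 <= b -> x `^ p * U + b `^ p * Z <= I ->
  c `^ p * U <= I /\ (I = c `^ p * U -> x = c /\ b = 0).
Proof.
move=> p1 U0 Z0 c0 cx b0 low; have p0 : 0 < p := lt_le_trans ltr01 p1.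
have x0 := le_trans c0 cx.
have cxp : c `^ p * U <= x `^ p * U.
  by rewrite ler_pM2r//; apply: ge0_ler_powR; rewrite ?nnegrE// ltW.
have bZ : 0 <= b `^ p * Z by rewrite mulr_ge0 ?powR_ge0// ltW.
split; first by lra.
move=> IE; have bZ0 : b `^ p * Z = 0 by lra.
have b00 : b = 0.
  move/eqP: bZ0; rewrite mulf_eq0 (gt_eqF Z0) orbF => /eqP; exact: powR_eq0_eq0.
split => //; apply/eqP; rewrite eq_le cx andbT leNgt; apply/negP => lt.
have : c `^ p < x `^ p by apply: gt0_ltr_powR; rewrite ?nnegrE.
by rewrite -(ltr_pM2r U0) ltNge; move: cxp low; rewrite IE bZ0 addr0 => _ ->.
Qed.

Lemma ReD (R : realType) (x y : R[i]) :
  complex.Re (x + y) = complex.Re x + complex.Re y.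
Proof. by case: x; case: y. Qed.

Lemma half_le_max (R : realType) (c x y m : R) :
  c <= x + y -> x <= m -> y <= m -> c / 2 <= m.
Proof. by move=> *; lra. Qed.

Section VarianceBounds.
Context {R : realType} {n : nat}.
Local Notation am := (@angular_momentum R[i] n.+1 (n%:R / 2)).
Local Notation s := (spin R n).
Implicit Types (L : 'I_3 -> 'M[R[i]]_n.+1) (rho : 'M[R[i]]_n.+1) (e : 'rV[R]_3).

Lemma spin_ge0 : 0 <= s.
Proof. by rewrite /spin divr_ge0. Qed.

(** Exhibits the constant as the [p]-norm of the coherent profile [s / 2 * transverse]; the Gamma
    quotient is half the sine integral, and [transverse_int p] is [2 * pi] times it. *)
Lemma c_spinE (p : R) : 1 <= p ->
  c_spin p%:E s = ((s / 2) `^ p * transverse_int p / (4 * pi)) `^ p^-1.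
Proof.
move=> p1; have p0 : p != 0 by rewrite lt0r_neq0// (lt_le_trans ltr01).
have s20 : 0 <= s / 2 by rewrite divr_ge0// spin_ge0.
have pin0 := lt0r_neq0 (pi_gt0 R).
rewrite /c_spin (wallis_Gamma p1).
have -> : sine_power_int (p := p) / 2 = transverse_int p / (4 * pi).
  have pi4 : 4 * pi != 0 :> R by rewrite mulf_neq0// pnatr_eq0.
  apply: (mulIf pi4); rewrite divfK// (transverse_intE p1) -/(sine_power_int (p := p)).
  by move: (sine_power_int (p := p)) => W; field.
have I0 : 0 <= transverse_int p / (4 * pi).
  by rewrite divr_ge0 ?mulr_ge0 ?pi_ge0// ltW// transverse_int_gt0.
rewrite -[_ * transverse_int p / _]mulrA; move: (transverse_int p / _) I0 => X X0.
rewrite (powRM _ (powR_ge0 _ _) X0).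
by rewrite -powRrM mulfV// powRr1.
Qed.

Lemma spin_cov_bounds L rho : am L -> density_op rho ->
  \tr (rho *m L 0) = 0 -> \tr (rho *m L 1) = 0 ->
  s <= spin_cov L rho 0 0 + spin_cov L rho 1 1 /\ 0 <= spin_cov L rho 2 2.
Proof.
move=> h hrho t0 t1; split.
  rewrite /spin_cov t0 t1 mul0r subr0 subr0.
  have s0 : 0 <= n%:R / 2 :> R[i] by rewrite divr_ge0 ?ler0n.
  have := transverse_moment_ge s0 h hrho; rewrite -spinC => /le_Re.
  by rewrite ReD.
have := spin_var_ge0 (row3 0 0 1) h hrho.
by rewrite spin_var_qform; have [_ _ ->] := qform_axes (spin_cov L rho).
Qed.

Lemma spin_var_axes L rho :
  spin_var L rho (row3 1 0 0) = spin_cov L rho 0 0 /\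
  spin_var L rho (row3 0 1 0) = spin_cov L rho 1 1.
Proof.
by rewrite spin_var_qform; have [-> -> _] := qform_axes (spin_cov L rho).
Qed.

Lemma variance_lower_bound p L rho : (1%:E <= p)%E -> am L -> density_op rho ->
  c_spin p s <= sphere_norm p (spin_var L rho).
Proof.
move=> p1 h hrho; have [k [u [w [z [r [uw zr t0 t1 _]]]]]] := align_mean h hrho.
rewrite -(sphere_norm_align p1 uw zr h hrho).
have hK := am_align uw zr h; move: (align u w z r L) hK t0 t1 => K hK t0 t1.
have [b01 b2] := spin_cov_bounds hK hrho t0 t1.
have v0 e := spin_var_ge0 e hK hrho.
have s0 := spin_ge0.
case: p p1 => [p||//]; rewrite ?lee_fin => p1.
  have p0 : 0 < p := lt_le_trans ltr01 p1.
  have I0 := transverse_int_gt0 p1; have J0 := axial_int_gt0 p1.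
  rewrite (c_spinE p1) /sphere_norm; rewrite spin_var_qform in v0 *.
  have pi0 : 0 <= (4 * pi)^-1 :> R by rewrite invr_ge0 mulr_ge0 ?pi_ge0.
  have low := sphere_int_qform_ge p1 v0.
  have c0 : 0 <= s / 2 by rewrite divr_ge0.
  have cx : s / 2 <= (spin_cov K rho 0 0 + spin_cov K rho 1 1) / 2 by rewrite ler_pM2r.
  have [le _] := powR_sum_bound p1 I0 J0 c0 cx b2 low.
  have le' := ler_wpM2r pi0 le.
  have l0 := mulr_ge0 (mulr_ge0 (powR_ge0 (s / 2) p) (ltW I0)) pi0.
  have mono (x y : R) : 0 <= x -> x <= y -> x `^ p^-1 <= y `^ p^-1.
    move=> x0 xy; apply: ge0_ler_powR => //; first by rewrite invr_ge0 ltW.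
    by rewrite nnegrE (le_trans x0 xy).
  exact: (mono _ _ l0 le').
(* The values on the first two axes add up to at least [s], so one of them is at least [s / 2]. *)
have [e [_ <- hmax]] := sphere_max (@continuous_spin_var R n K rho).
have [E0 E1] := spin_var_axes K rho.
have h0 : spin_var K rho (row3 1 0 0) <= spin_var K rho e.
  by apply: hmax; apply/sphere2E; rewrite !row3E expr0n expr1n !addr0.
have h1 : spin_var K rho (row3 0 1 0) <= spin_var K rho e.
  by apply: hmax; apply/sphere2E; rewrite !row3E expr0n expr1n add0r addr0.
rewrite E0 in h0; rewrite E1 in h1; exact: (half_le_max b01 h0 h1).
Qed.

Lemma variance_equality p L rho : 1 <= p -> am L -> density_op rho ->
  sphere_norm p%:E (spin_var L rho) = c_spin p%:E s -> spin_coherent L rho.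
Proof.
move=> p1 h hrho; have pe : (1%:E <= p%:E)%E by rewrite lee_fin.
have [k [u [w [z [r [uw zr t0 t1 [k0 t2]]]]]]] := align_mean h hrho.
rewrite -(sphere_norm_align pe uw zr h hrho).
have K2 : align u w z r L 2 = dot_mx (row3 (r * u) (r * w) z) L.
  by rewrite align2 dot_mxE !row3E !rmorphM /=; exact: lin3_nested.
have hK := am_align uw zr h; move: (align u w z r L) hK t0 t1 t2 K2 => K hK t0 t1 t2 K2.
have [b01 b2] := spin_cov_bounds hK hrho t0 t1.
have v0 e := spin_var_ge0 e hK hrho.
have s0 := spin_ge0.
have p0 : 0 < p := lt_le_trans ltr01 p1.
have I0 := transverse_int_gt0 p1; have J0 := axial_int_gt0 p1.
rewrite (c_spinE p1) /sphere_norm; rewrite spin_var_qform in v0 *.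
have pi4 : 0 < 4 * pi :> R by rewrite mulr_gt0 ?pi_gt0.
have low := sphere_int_qform_ge p1 v0.
set I := sphere_int _ in low *.
have c0 : 0 <= s / 2 by rewrite divr_ge0.
have cx : s / 2 <= (spin_cov K rho 0 0 + spin_cov K rho 1 1) / 2 by rewrite ler_pM2r.
have [le eqI] := powR_sum_bound p1 I0 J0 c0 cx b2 low.
have Iu0 := mulr_ge0 (powR_ge0 (s / 2) p) (ltW I0).
have Ige0 := le_trans Iu0 le.
have ip0 : 0 < p^-1 by rewrite invr_gt0.
move=> /(powR_injective ip0); rewrite !nnegrE (divr_ge0 Ige0 (ltW pi4)) (divr_ge0 Iu0 (ltW pi4)).
move=> /(_ isT isT) /(mulIf (invr_neq0 (lt0r_neq0 pi4))) /eqI[aE b0].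
have sC0 : 0 <= n%:R / 2 :> R[i] by rewrite divr_ge0 ?ler0n.
(* Only the real part is known to be [s]; the complex inequality [transverse_moment_ge] supplies the
   vanishing of the imaginary part. *)
have mom : \tr (rho *m (K 0 *m K 0)) + \tr (rho *m (K 1 *m K 1)) = n%:R / 2.
  have := transverse_moment_ge sC0 hK hrho; rewrite -spinC.
  have : complex.Re (\tr (rho *m (K 0 *m K 0)) + \tr (rho *m (K 1 *m K 1))) = s.
    have : spin_cov K rho 0 0 + spin_cov K rho 1 1 = s.
      by apply: (mulIf _ aE); rewrite invr_neq0// pnatr_eq0.
    rewrite /spin_cov t0 t1 mul0r subr0 subr0.
    by rewrite ReD.
  move: (_ + _) => x xE; rewrite lecE => /andP[/eqP Im_x _].
  by apply/eqP; rewrite eq_complex xE Im_x !eqxx.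
have m2 := transverse_moment_eq hK hrho mom.
(* [V_33 = 0] with second moment [s ^+ 2] gives [k ^+ 2 = s ^+ 2]; the sign is settled by [0 <= k]
   from [align_mean]. *)
have ks : k = s.
  have : spin_cov K rho 2 2 = s ^+ 2 - k ^+ 2.
    by rewrite /spin_cov m2 t2 -spinC -rmorphXn -rmorphM -rmorphB expr2.
  rewrite b0 => /esym/eqP; rewrite subr_eq0 eqrXn2// => /eqP ->.
  by [].
have [phi [phi1 Lphi rhoE]] := highest_weight_pure hK hrho (etrans t2 (etrans (congr1 _ ks) spinC)).
exists (row3 (r * u) (r * w) z), phi; split.
- apply/sphere2E; rewrite !row3E.
  transitivity (z ^+ 2 + r ^+ 2 * (u ^+ 2 + w ^+ 2)); first by ring.
  by rewrite uw mulr1.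
- exact: phi1.
- by rewrite -K2 spinC.
- exact: rhoE.
Qed.

Lemma spin_var_extremal L (phi : 'cV[R[i]]_n.+1) (eps : R) e : am L -> eps ^+ 2 = 1 ->
  phi^t* *m phi = 1%:M -> L 2 *m phi = (eps * s)%:C *: phi ->
  \tr (pure_state phi *m dot_mx e L) = (e ord0 2 * eps * s)%:C /\
  \tr (pure_state phi *m (dot_mx e L *m dot_mx e L)) =
    (s / 2 * transverse e + e ord0 2 ^+ 2 * s ^+ 2)%:C.
Proof.
move=> h e1 phi1 Lphi.
have er : eps%:C ^+ 2 = 1 :> R[i] by rewrite -rmorphXn e1.
have sr : n%:R / 2 \is (@Num.real R[i]) by rewrite -spinC; exact: real_complex_real.
have Lphi' : L 2 *m phi = (eps%:C * (n%:R / 2)) *: phi.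
  by rewrite Lphi rmorphM /= spinC.
have := extremal_moments h (real_complex_real eps) er sr (real_complex_real (e ord0 0))
  (real_complex_real (e ord0 1)) (real_complex_real (e ord0 2)) phi1 Lphi'.
rewrite -dot_mxE -spinC => -[-> ->]; split.
  by rewrite !rmorphM.
by rewrite /transverse !(rmorphD, rmorphM, rmorphXn, fmorphV, rmorph_nat).
Qed.

(** An upper bound at every direction suffices, the opposite inequality being
    [variance_lower_bound]. *)
Lemma pinfty_equality L rho : am L -> density_op rho ->
  (forall e, sphere2 e -> spin_var L rho e <= s / 2) ->
  sphere_norm +oo%E (spin_var L rho) = c_spin +oo%E s.
Proof.
move=> h hrho hle; apply/eqP; rewrite eq_le variance_lower_bound ?leey// andbT.
by have [e [he <- _]] := sphere_max (@continuous_spin_var R n L rho); exact: hle.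
Qed.

Lemma coherent_density L rho : spin_coherent L rho -> density_op rho.
Proof. by move=> [e [phi [_ phi1 _ ->]]]; exact: (pure_density phi1). Qed.

Lemma coherent_norm p L rho : (1%:E <= p)%E -> am L -> spin_coherent L rho ->
  sphere_norm p (spin_var L rho) = c_spin p s.
Proof.
move=> p1 h hc; have hrho := coherent_density hc.
have [e [phi [he phi1 Lphi rhoE]]] := hc.
have [u [w [z [r [uw zr K2]]]]] := align_dir L he.
rewrite -(sphere_norm_align p1 uw zr h hrho).
have hK := am_align uw zr h; move: (align u w z r L) hK K2 => K hK K2.
have s0 := spin_ge0.
(* The term [z^2 s^2] of the second moment cancels against the squared mean. *)
have vE : spin_var K rho = fun e' => s / 2 * transverse e'.
  apply/funext => e'.
  have Lphi' : K 2 *m phi = (1 * s)%:C *: phi by rewrite K2 mul1r.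
  have [m1 m2] := spin_var_extremal e' hK (expr1n _ _) phi1 Lphi'.
  rewrite /spin_var rhoE m1 m2 -rmorphXn -rmorphB.
  by rewrite [LHS]/=; ring.
case: p p1 => [p||//]; rewrite ?lee_fin => p1.
  rewrite vE (c_spinE p1) /sphere_norm sphere_int_transverseZ//.
  by rewrite divr_ge0.
apply: pinfty_equality => // e' /sphere2E he'; rewrite vE.
rewrite -[leRHS]mulr1 ler_wpM2l ?divr_ge0// -he' /transverse.
by rewrite lerDl sqr_ge0.
Qed.

(** * Mixtures of the highest and the lowest weight state *)

Section Mixture.
Variables (L : 'I_3 -> 'M[R[i]]_n.+1) (ket : 'I_n.+1 -> 'cV[R[i]]_n.+1) (qp qm : R).
Hypotheses (hn : (0 < n)%N) (hL : am L) (hket : L3_basis L ket).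
Hypotheses (qp0 : 0 <= qp) (qm0 : 0 <= qm) (qq : qp + qm = 1).
Hypothesis qpqm : qp * qm <= 1 / (8 * s).

Let rho := qp%:C *: pure_state (ket ord0) + qm%:C *: pure_state (ket ord_max).

Let ket1 k : (ket k)^t* *m ket k = 1%:M.
Proof. by rewrite hket.1 eqxx. Qed.

Lemma mixture_density : density_op rho.
Proof.
apply: (mix_density (q := qp%:C) (q' := qm%:C)).
- by rewrite lecR.
- by rewrite lecR.
- by rewrite -rmorphD qq.
- exact: (pure_density (ket1 _)).
- exact: (pure_density (ket1 _)).
Qed.

Lemma mixture_var_le e : sphere2 e -> spin_var L rho e <= s / 2.
Proof.
move=> /sphere2E he.
have Lp : L 2 *m ket ord0 = (1 * s)%:C *: ket ord0 by rewrite hket.2 subr0 mul1r.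
(* [ord_max] is the index [n], so its weight is [s - n = - s]. *)
have Lm : L 2 *m ket ord_max = (- 1 * s)%:C *: ket ord_max.
  by rewrite hket.2; congr (_%:C *: _); rewrite /spin /=; field.
have N1 : (- 1) ^+ 2 = 1 :> R by rewrite sqrrN expr1n.
have [p1 p2] := spin_var_extremal e hL (expr1n _ _) (ket1 _) Lp.
have [m1 m2] := spin_var_extremal e hL N1 (ket1 _) Lm.
have trE M : \tr (rho *m M) = qp%:C * \tr (pure_state (ket ord0) *m M) +
    qm%:C * \tr (pure_state (ket ord_max) *m M).
  exact: trace_lin2l.
rewrite /spin_var !trE p1 p2 m1 m2 -!rmorphM -!rmorphD -rmorphXn -rmorphB [leLHS]/=.
set T := transverse e; set z := e ord0 2.
have Tz : T = 1 - z ^+ 2 by rewrite /T /transverse -he addrK.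
have s0 : 0 < s by rewrite /spin divr_gt0// ltr0n.
have b : 4 * s ^+ 2 * (qp * qm) <= s / 2.
  have := ler_wpM2l (_ : 0 <= 4 * s ^+ 2) qpqm; rewrite mulr_ge0 ?sqr_ge0// => /(_ isT).
  move=> /le_trans; apply; rewrite le_eqVlt; apply/orP; left; apply/eqP.
  by field; exact: lt0r_neq0.
(* The means along [e] are [z s] and [- z s], and [1 - (qp - qm)^2 = 4 qp qm]. With [T = 1 - z ^+ 2]
   the bound [b] finishes. *)
rewrite (_ : _ - _ = s / 2 * T + (4 * s ^+ 2 * (qp * qm)) * z ^+ 2).
  have := ler_wpM2r (sqr_ge0 z) b; rewrite Tz.
  by rewrite -/z; move: (4 * _ * _ * _) => x; lra.
have -> : qm = 1 - qp by rewrite -qq; ring.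
by ring.
Qed.

End Mixture.

End VarianceBounds.

(** * Covariance under SU(2) *)

Lemma ord2_ind (P : 'I_2 -> Prop) : P 0 -> P 1 -> forall j, P j.
Proof.
move=> P0 P1 [[|[|//]] hj].
- by rewrite (_ : Ordinal hj = 0)//; exact: val_inj.
- by rewrite (_ : Ordinal hj = 1)//; exact: val_inj.
Qed.

Section TwoByTwo.
Context {T : comNzRingType}.

Lemma eq_mx2 (A B : 'M[T]_2) : A 0 0 = B 0 0 -> A 0 1 = B 0 1 -> A 1 0 = B 1 0 ->
  A 1 1 = B 1 1 -> A = B.
Proof.
move=> e00 e01 e10 e11; apply/matrixP => i j.
by elim/ord2_ind: i; elim/ord2_ind: j.
Qed.

Lemma sum2 (V : nmodType) (F : 'I_2 -> V) : \sum_(j < 2) F j = F 0 + F 1.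
Proof.
rewrite !big_ord_recl big_ord0 addr0.
by congr (_ + _); congr F; apply: val_inj.
Qed.

Lemma mulmx2 (A B : 'M[T]_2) i j : (A *m B) i j = A i 0 * B 0 j + A i 1 * B 1 j.
Proof. by rewrite mxE sum2. Qed.

Lemma det_mx2 (A : 'M[T]_2) : \det A = A 0 0 * A 1 1 - A 0 1 * A 1 0.
Proof.
rewrite (expand_det_row _ 0) sum2 /cofactor !det_mx11 !mxE /= expr0 expr1 mul1r mulN1r mulrN.
by congr (_ * A _ _ - _ * A _ _); apply: val_inj.
Qed.

End TwoByTwo.

Section Rotations.
Context {R : realType}.
Implicit Types (e : 'rV[R]_3) (t : R).
Local Notation X e := (dot_mx e (@pauli R)).

Lemma pauli_dotE e : [/\ X e 0 0 = (e ord0 2)%:C,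
  X e 0 1 = Complex (e ord0 0) (- e ord0 1), X e 1 0 = Complex (e ord0 0) (e ord0 1) &
  X e 1 1 = - (e ord0 2)%:C].
Proof.
rewrite /dot_mx sum3 /pauli/=.
split; rewrite !mxE /=; apply/eqP; rewrite eq_complex /=;
  by apply/andP; split; apply/eqP; ring.
Qed.

Lemma pauli_herm e : (X e)^t* = X e.
Proof.
have [e00 e01 e10 e11] := pauli_dotE e.
apply: eq_mx2; rewrite !mxE ?e00 ?e01 ?e10 ?e11; apply/eqP; rewrite eq_complex /=;
  by rewrite ?oppr0 ?opprK !eqxx.
Qed.

Lemma pauli_trace e : \tr (X e) = 0.
Proof.
have [e00 _ _ e11] := pauli_dotE e.
by rewrite /mxtrace sum2 e00 e11 subrr.
Qed.

Lemma pauli_sqr e : sphere2 e -> X e *m X e = 1%:M.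
Proof.
move=> /sphere2E he; have [e00 e01 e10 e11] := pauli_dotE e.
apply: eq_mx2; rewrite mulmx2 mxE /= ?e00 ?e01 ?e10 ?e11; apply/eqP; rewrite eq_complex /=;
  apply/andP; split; apply/eqP; rewrite ?mulr1n ?mulr0n /= -?he; ring.
Qed.

(** Hermitian traceless matrices are the real combinations of the Pauli matrices, and the square of
    such a combination is its squared length times the identity. *)
Lemma traceless_involution (Y : 'M[R[i]]_2) : Y^t* = Y -> \tr Y = 0 -> Y *m Y = 1%:M ->
  exists2 e, sphere2 e & Y = X e.
Proof.
move=> Yh Yt YY; pose e := row3 (complex.Re (Y 0 1)) (- complex.Im (Y 0 1)) (complex.Re (Y 0 0)).
have [e00 e01 e10 e11] := pauli_dotE e; rewrite !row3E in e00 e01 e10 e11.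
have h00 : Y 0 0 = (complex.Re (Y 0 0))%:C.
  have := congr1 (fun M : 'M[R[i]]_2 => M 0 0) Yh; rewrite !mxE.
  by case: (Y 0 0) => a b [/eqP]; rewrite eqNr => /eqP ->.
have h10 : Y 1 0 = Complex (complex.Re (Y 0 1)) (- complex.Im (Y 0 1)).
  have := congr1 (fun M : 'M[R[i]]_2 => M 1 0) Yh; rewrite !mxE => <-.
  by case: (Y 0 1).
have h11 : Y 1 1 = - Y 0 0.
  by apply/eqP; rewrite -addr_eq0 addrC; move: Yt; rewrite /mxtrace sum2 => ->.
exists e; last first.
  apply: eq_mx2; rewrite ?e00 ?e01 ?e10 ?e11//.
  - by rewrite opprK; case: (Y 0 1).
  - by rewrite h11 {1}h00.
have := congr1 (fun M : 'M[R[i]]_2 => complex.Re (M 0 0)) YY.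
rewrite mulmx2 h10 h00 mxE /= => H; apply/sphere2E; rewrite /e !row3E; move: H.
by case: (Y 0 1) => a b /= H; rewrite -[RHS]H; ring.
Qed.

Lemma su2_rotE e t : su2_rot e t = (cos (t / 2))%:C%:M - ('i * (sin (t / 2))%:C) *: X e.
Proof. by rewrite /su2_rot scalemx1. Qed.

Lemma su2_rot_SU2 e t : sphere2 e -> SU2 (su2_rot e t).
Proof.
move=> /sphere2E he; have [e00 e01 e10 e11] := pauli_dotE e.
set c := cos (t / 2); set d := sin (t / 2).
have cd : c ^+ 2 + d ^+ 2 = 1 by exact: cos2Dsin2.
have r00 : su2_rot e t 0 0 = Complex c (- d * e ord0 2).
  rewrite /su2_rot -/c -/d !mxE e00; apply/eqP; rewrite eq_complex /=.
  by apply/andP; split; apply/eqP; ring.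
have r01 : su2_rot e t 0 1 = Complex (- d * e ord0 1) (- d * e ord0 0).
  rewrite /su2_rot -/c -/d !mxE e01; apply/eqP; rewrite eq_complex /=.
  by apply/andP; split; apply/eqP; ring.
have r10 : su2_rot e t 1 0 = Complex (d * e ord0 1) (- d * e ord0 0).
  rewrite /su2_rot -/c -/d !mxE e10; apply/eqP; rewrite eq_complex /=.
  by apply/andP; split; apply/eqP; ring.
have r11 : su2_rot e t 1 1 = Complex c (d * e ord0 2).
  rewrite /su2_rot -/c -/d !mxE e11; apply/eqP; rewrite eq_complex /=.
  by apply/andP; split; apply/eqP; ring.
have norm1 : c ^+ 2 + d ^+ 2 * (e ord0 0 ^+ 2 + e ord0 1 ^+ 2 + e ord0 2 ^+ 2) = 1.
  by rewrite he mulr1.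
have adjE (A : 'M[R[i]]_2) i j : (A^t*) i j = (A j i)^*%R by rewrite !mxE.
split.
  apply/unitarymxP; apply: eq_mx2; rewrite mulmx2 !adjE ?r00 ?r01 ?r10 ?r11 mxE /=;
    apply/eqP; rewrite eq_complex /=; apply/andP; split; apply/eqP;
    rewrite ?mulr1n ?mulr0n /= -?norm1; ring.
rewrite det_mx2 r00 r01 r10 r11; apply/eqP; rewrite eq_complex /=.
by apply/andP; split; apply/eqP; rewrite -?norm1; ring.
Qed.

Lemma SU2_adj (g : 'M[R[i]]_2) : SU2 g ->
  [/\ SU2 (g^t*), g^t* *m g = 1%:M & g *m g^t* = 1%:M].
Proof.
move=> [gu gdet]; have gg : g *m g^t* = 1%:M by apply/unitarymxP.
split; [|exact: mulmx1C|exact: gg].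
split; first by rewrite trmxC_unitary.
have := congr1 (fun M => \det M) gg; rewrite det_mulmx det1.
by have -> : \det g = 1 := gdet; rewrite mul1r.
Qed.

(** The covering of the rotation group by [SU2], one direction at a time: conjugation keeps
    [dot_mx e (@pauli R)] Hermitian, traceless and involutive, so [traceless_involution] yields the
    new direction. *)
Lemma su2_rot_conj (g : 'M[R[i]]_2) e : SU2 g -> sphere2 e ->
  exists2 e', sphere2 e' & forall t, g^t* *m su2_rot e t *m g = su2_rot e' t.
Proof.
move=> hg he; have [_ gg gg'] := SU2_adj hg.
have [|||e' he' YE] := @traceless_involution (g^t* *m X e *m g).
- by rewrite !adjmxM trmxCK pauli_herm mulmxA.
- by rewrite mxtrace_mulC mulmxA gg' mul1mx pauli_trace.
- rewrite -!mulmxA (mulmxA g) gg' mul1mx (mulmxA (X e)) pauli_sqr//.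
  by rewrite mul1mx.
exists e' => // t; rewrite !su2_rotE -YE mulmxBr mulmxBl; congr (_ - _).
  by rewrite mul_mx_scalar -scalemxAl gg scalemx1.
by rewrite -scalemxAr -scalemxAl.
Qed.

End Rotations.

Lemma num_cvg_unique (K : numFieldType) (T : Type) (F : set_system T) (f : T -> K) (a b : K) :
  ProperFilter F -> f @ F --> a -> f @ F --> b -> a = b.
Proof.
move=> FF ha hb; have hT : hausdorff_space K^o by exact: norm_hausdorff.
exact: (@cvg_unique K^o hT (f @ F) _ a b ha hb).
Qed.

Lemma continuous_sandwich (K : numFieldType) (d : nat) (A B : 'M[K]_d) i j :
  continuous (fun M : 'M[K]_d => (A *m M *m B) i j).
Proof.
have -> : (fun M : 'M[K]_d => (A *m M *m B) i j) =
    fun M => \sum_k \sum_l A i l * M l k * B k j.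
  apply/funext => M; rewrite mxE; apply: eq_bigr => k _.
  by rewrite mxE mulr_suml.
move=> M; apply: (@cvg_big _ _ _ _ _ _ _ (nbhs M)) => [|k _]; first exact: add_continuous.
apply: (@cvg_big _ _ _ _ _ _ _ (nbhs M)) => [|l _]; first exact: add_continuous.
apply: (@cvgM _ _ (nbhs M)); last exact: cvg_cst.
by apply: (@cvgM _ _ (nbhs M)); [exact: cvg_cst|exact: coord_continuous].
Qed.

Section Covariance.
Context {R : realType} {n : nat} {U : 'M[R[i]]_2 -> 'M[R[i]]_n.+1}
  {L : 'I_3 -> 'M[R[i]]_n.+1}.
Hypothesis hUL : spin_rep U L.

Lemma spin_rep_am : angular_momentum (n%:R / 2 : R[i]) L.
Proof.
split; [exact: (spin_herm hUL)|exact: (spin_comm hUL)|].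
by have := spin_casimir hUL; rewrite rmorphM rmorphD rmorph1 /= spinC.
Qed.

Lemma spin_rep_unitary g : SU2 g -> (U g)^t* *m U g = 1%:M.
Proof. by move=> /(spin_unitary hUL)/unitarymxP/mulmx1C. Qed.

Lemma spin_rep_adj g : SU2 g -> U (g^t*) = (U g)^t*.
Proof.
move=> hg; have [hg' gg _] := SU2_adj hg.
have UU : U g *m (U g)^t* = 1%:M by apply/unitarymxP; exact: (spin_unitary hUL).
by rewrite -[LHS]mulmx1 -UU mulmxA -(spin_mul hUL)// gg (spin_one hUL) mul1mx.
Qed.

(* Both sides generate the one-parameter group t |-> U (g^* su2_rot e t g). *)
Lemma generator_conj g e : SU2 g -> sphere2 e ->
  exists2 e', sphere2 e' & (U g)^t* *m dot_mx e L *m U g = dot_mx e' L.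
Proof.
move=> hg he; have [e' he' rotE] := su2_rot_conj hg he.
exists e' => //; have [hg' gg _] := SU2_adj hg.
pose F (e : 'rV[R]_3) (t : R) := (t^-1)%:C *: (U (su2_rot e t) - 1%:M).
have FE t : F e' t = (U g)^t* *m F e t *m U g.
  have hr := su2_rot_SU2 t he.
  have hgr : SU2 (g^t* *m su2_rot e t).
    have [[u1 d1] [u2 d2]] := (hg', hr); split; first exact: mul_unitarymx.
    by rewrite det_mulmx (d2 : \det (su2_rot e t) = 1) mulr1.
  rewrite /F -rotE (spin_mul hUL hgr hg) (spin_mul hUL hg' hr) spin_rep_adj//.
  by rewrite -scalemxAr -scalemxAl mulmxBr mulmxBl mulmx1 spin_rep_unitary.
have lim1 := spin_gen hUL he'; have lim2 := spin_gen hUL he.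
(* Both sides are limits of [F e'] at [0]; they are compared entry by entry, conjugation being
   continuous. *)
have key : - 'i *: dot_mx e' L = (U g)^t* *m (- 'i *: dot_mx e L) *m U g.
  apply/matrixP => i j.
  pose f t := F e' t i j.
  have l1 : f t @[t --> 0^'] --> (- 'i *: dot_mx e' L) i j.
    exact: cvg_comp _ _ lim1 (@coord_continuous R[i] _ _ i j (- 'i *: dot_mx e' L)).
  have l2 : f t @[t --> 0^'] --> ((U g)^t* *m (- 'i *: dot_mx e L) *m U g) i j.
    rewrite (_ : f = (fun M : 'M[R[i]]_n.+1 => ((U g)^t* *m M *m U g) i j) \o F e).
      exact: cvg_comp _ _ lim2 (@continuous_sandwich R[i] _ ((U g)^t*) (U g) i j (- 'i *: dot_mx e L)).
    by apply/funext => t; rewrite /f FE.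
  have PF : ProperFilter (0 : R)^' by exact: _.
  exact: (num_cvg_unique PF l1 l2).
rewrite -scalemxAr -scalemxAl in key.
by apply/esym/(scalerI _ key); rewrite oppr_eq0; (exact: neq0Ci || rewrite eq_complex /= oner_eq0 andbF).
Qed.

(** Cyclicity of the trace moves [U g] from the state to the observable, where [generator_conj]
    applies. The direction [e'] is the same for the mean and the second moment. *)
Lemma spin_var_conj g rho e : SU2 g -> sphere2 e ->
  exists2 e', sphere2 e' & spin_var L (U g *m rho *m (U g)^t*) e = spin_var L rho e'.
Proof.
move=> hg he; have [e' he' ge] := generator_conj hg he.
exists e' => //; have UU : U g *m (U g)^t* = 1%:M.
  by apply/unitarymxP; exact: (spin_unitary hUL).
have trE M : \tr (U g *m rho *m (U g)^t* *m M) = \tr (rho *m ((U g)^t* *m M *m U g)).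
  by rewrite -!mulmxA mxtrace_mulC -!mulmxA.
rewrite /spin_var !trE -ge; congr (complex.Re (\tr (rho *m _) - _)).
by rewrite -!mulmxA (mulmxA (U g)) UU mul1mx.
Qed.

End Covariance.

Theorem proposition1 (R : realType) (n : nat) (hn : (0 < n)%N)
    (U : 'M[R[i]]_2 -> 'M[R[i]]_n.+1) (L : 'I_3 -> 'M[R[i]]_n.+1)
    (hUL : spin_rep U L) :
  (forall p : \bar R, (1%:E <= p)%E ->
    (forall rho, density_op rho ->
       c_spin p (spin R n) <= sphere_norm p (spin_var L rho)) /\
    (forall rho, spin_coherent L rho ->
       sphere_norm p (spin_var L rho) = c_spin p (spin R n)) /\
    ((p < +oo)%E -> forall rho, density_op rho ->
       sphere_norm p (spin_var L rho) = c_spin p (spin R n) -> spin_coherent L rho)) /\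
  (forall ket, L3_basis L ket ->
     forall qp qm : R, 0 <= qp -> 0 <= qm -> qp + qm = 1 ->
       qp * qm <= 1 / (8 * spin R n) ->
     let rho := qp%:C *: pure_state (ket ord0) + qm%:C *: pure_state (ket ord_max) in
     sphere_norm +oo%E (spin_var L rho) = c_spin +oo%E (spin R n) /\
     forall g, SU2 g ->
       sphere_norm +oo%E (spin_var L (U g *m rho *m (U g)^t*)) =
         c_spin +oo%E (spin R n)) /\
  [/\ c_spin 1%:E (spin R n) = spin R n / 3,
      c_spin 2%:E (spin R n) = spin R n / 2 * Num.sqrt (8 / 15) &
      c_spin +oo%E (spin R n) = spin R n / 2].
Proof.
have h := spin_rep_am hUL; split; [|split].
- move=> p p1; split; [|split].
  + by move=> rho hrho; exact: variance_lower_bound.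
  + by move=> rho hc; exact: coherent_norm.
  + case: p p1 => [p||//] p1; last by rewrite ltxx.
    by move=> _ rho hrho; apply: variance_equality.
- move=> ket hket qp qm qp0 qm0 qq qpqm rho.
  have hrho : density_op rho := mixture_density hket qp0 qm0 qq.
  have hle e : sphere2 e -> spin_var L rho e <= spin R n / 2.
    exact: (mixture_var_le hn h hket qq qpqm).
  split; first exact: pinfty_equality.
  move=> g hg; apply: pinfty_equality => //.
    exact: (conj_density (spin_rep_unitary hUL hg) hrho).
  by move=> e he; have [e' he' ->] := spin_var_conj hUL rho hg he; exact: hle.
(* Half of the integrals of [sin^3] and [sin^5] over [[0, pi]] are [2/3] and [8/15], the Gamma
   quotients for [p = 1] and [p = 2]. *)
- have [_ t3 t5] := @trig_int_sin_1_3_5 R.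
  split; last by [].
  + have one : (1 : R) <= 1 := lexx 1.
    rewrite /c_spin (wallis_Gamma one) invr1 /sine_power_int.
    have -> := @sine_integral_nat R 1.
    by rewrite t3 powRr1; [field|rewrite divr_ge0].
  + have two : (1 : R) <= 2 by rewrite ler1n.
    rewrite /c_spin (wallis_Gamma two) /sine_power_int.
    have -> := @sine_integral_nat R 2.
    rewrite t5 powR12_sqrt; last by rewrite divr_ge0// divr_ge0.
    by congr (_ * Num.sqrt _); field.
Qed.
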